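(* Let $F$ be a non-archimedean local field with ring of integers $\mathcal O$, uniformizer $\pi$ and residue field of order $q$, let $r\ge1$ and $\mathcal O_r=\mathcal O/\pi^r\mathcal O$. The graph $\mathbb P^2_{\mathrm{fr}}(\mathcal O_r)$ is a $\left((q+1)q^{r-1}\right)$-regular connected bipartite graph on $2(q^2+q+1)q^{2(r-1)}$ vertices, whose adjacency spectrum (as a set) is $$\left\{\pm(q+1)q^{r-1},\ \pm\sqrt{q^{2r-1}},\ \pm\sqrt{q^{2r-2}},\ \ldots,\ \pm\sqrt{q^{r+1}},\ \pm\sqrt{q^{r}}\right\}.$$ In particular, its second-largest normalized eigenvalue equals $\frac{\sqrt q}{q+1}$, independently of $r$.
   Context: A module over $\mathcal O_r$ is free if it is isomorphic to $\mathcal O_r^{\oplus m}$ for some $m$. The free projective plane $\mathbb P^2_{\mathrm{fr}}(\mathcal O_r)$ is the complex whose vertices are the free $\mathcal O_r$-submodules $0<M<\mathcal O_r^3$ (proper and nonzero), and whose cells are the free flags, i.e. chains of such submodules under inclusion. It is a graph: two distinct vertices are adjacent iff one is contained in the other. Normalized eigenvalues are the adjacency eigenvalues divided by the degree. *)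

(* Defs.v *)
From HB Require Import structures.
From mathcomp Require Import all_boot all_order all_algebra.
From mathcomp Require Import ring_quotient.
From mathcomp Require Import boolp classical_sets functions cardinality reals.
From Stdlib Require Import Relation_Operators.

Set Implicit Arguments.
Unset Strict Implicit.
Unset Printing Implicit Defensive.

Import Order.TTheory GRing.Theory Num.Theory.
Local Open Scope classical_set_scope.
Local Open Scope card_scope.
Local Open Scope ring_scope.

(* [dval v 0] is unconstrained: the usual convention [v 0 = +oo] is built into
   [val_ge] below. The valuation is normalized, i.e., onto the integers. *)
Record discreteValuation (F : fieldType) := DiscreteValuation {
  dval :> F -> int;
  dvalM : forall x y, x != 0 -> y != 0 -> dval (x * y) = dval x + dval y;
  dvalD : forall x y, x != 0 -> y != 0 -> x + y != 0 ->
    Num.min (dval x) (dval y) <= dval (x + y);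
  dval_onto : exists2 x, x != 0 & dval x = 1
}.

Section Valuation.
Variables (F : fieldType) (v : discreteValuation F).

Definition val_ge (N : int) : {pred F} := fun x => (x == 0) || (N <= v x).

Definition val_cauchy (u : nat -> F) :=
  forall N : int, exists n0 : nat, forall m n : nat,
    (n0 <= m)%N -> (n0 <= n)%N -> u m - u n \in val_ge N.

Definition val_cvg (u : nat -> F) (l : F) :=
  forall N : int, exists n0 : nat, forall n : nat,
    (n0 <= n)%N -> u n - l \in val_ge N.

Definition val_complete :=
  forall u : nat -> F, val_cauchy u -> exists l : F, val_cvg u l.

Lemma dval1 : v 1 = 0.
Proof.
have := dvalM v (oner_neq0 F) (oner_neq0 F).
by rewrite mulr1 => /eqP; rewrite -subr_eq subrr => /eqP.
Qed.

Lemma dvalN x : x != 0 -> v (- x) = v x.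
Proof.
have N1 : (-1 : F) != 0 by rewrite oppr_eq0 oner_neq0.
have vN1 : v (-1) = 0.
  have := dvalM v N1 N1; rewrite mulrNN mulr1 dval1 => /esym/eqP.
  by rewrite -mulr2n mulrn_eq0 => /eqP.
by move=> x0; rewrite -mulN1r dvalM // vN1 add0r.
Qed.

Lemma val_geN N x : x \in val_ge N -> - x \in val_ge N.
Proof.
rewrite !unfold_in oppr_eq0; case: eqVneq => //= x0.
by rewrite dvalN.
Qed.

Lemma val_geD N x y : x \in val_ge N -> y \in val_ge N -> x + y \in val_ge N.
Proof.
rewrite !unfold_in.
have [-> _|x0 /= vx] := eqVneq x 0; first by rewrite add0r.
have [-> _|y0 /= vy] := eqVneq y 0; first by rewrite addr0 vx orbT.
have [//|xy0 /=] := eqVneq (x + y) 0.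
by apply: le_trans (dvalD v x0 y0 xy0); rewrite le_min vx.
Qed.

Lemma val_geM N M x y :
  x \in val_ge N -> y \in val_ge M -> x * y \in val_ge (N + M).
Proof.
rewrite !unfold_in mulf_eq0; case: eqVneq => //= x0 vx.
by case: eqVneq => //= y0 vy; rewrite dvalM // lerD.
Qed.

Definition valuation_ring : {pred F} := val_ge 0.

Lemma valuation_ring_closed : subring_closed valuation_ring.
Proof.
split=> [|x y xO yO|x y xO yO].
- by rewrite unfold_in /valuation_ring /val_ge dval1 lexx orbT.
- by apply: val_geD => //; apply: val_geN.
- by have := val_geM xO yO; rewrite addr0.
Qed.

HB.instance Definition _ :=
  GRing.isSubringClosed.Build F valuation_ring valuation_ring_closed.

Record integers :=
  Integers { integers_val :> F; _ : integers_val \in valuation_ring }.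

HB.instance Definition _ := [isSub for integers_val].
HB.instance Definition _ := [Choice of integers by <:].
HB.instance Definition _ := [SubChoice_isSubComNzRing of integers by <:].

Definition maximal_ideal : {pred integers} :=
  fun x => integers_val x \in val_ge 1.

Lemma maximal_ideal_closed : idealr_closed maximal_ideal.
Proof.
split.
- by rewrite !unfold_in eqxx.
- by rewrite !unfold_in oner_eq0 dval1.
- move=> a x y xm ym; apply: val_geD ym.
  by have := val_geM (valP a) xm; rewrite add0r.
Qed.

HB.instance Definition _ :=
  isIdealr.Build integers maximal_ideal maximal_ideal_closed.

Definition residue_field := {ideal_quot maximal_ideal}.

Definition nonarchimedean_local_field :=
  val_complete /\ finite_set [set: residue_field].

Definition uniformizer (p : integers) :=
  integers_val p != 0 /\ v (integers_val p) = 1.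

End Valuation.

Arguments maximal_ideal {F} v.

(* The library only forms quotients by proper ideals, whence the argument [hx];
   it plays no role in the underlying set [{x * y | y}]. *)
Definition principal_ideal (A : comNzRingType) (x : A)
    (hx : ~ exists y, x * y = 1) : {pred A} :=
  fun z => `[< exists y, z = x * y >].

Lemma principal_ideal_closed (A : comNzRingType) (x : A)
  (hx : ~ exists y, x * y = 1) : idealr_closed (principal_ideal hx).
Proof.
split.
- by apply/asboolP; exists 0; rewrite mulr0.
- by apply/asboolP => -[y /esym xy]; apply: hx; exists y.
- move=> a _ _ /asboolP[y ->] /asboolP[z ->]; apply/asboolP.
  by exists (a * y + z); rewrite mulrDr mulrCA.
Qed.

HB.instance Definition _ (A : comNzRingType) (x : A)
    (hx : ~ exists y, x * y = 1) :=
  isIdealr.Build A (principal_ideal hx) (principal_ideal_closed hx).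

Lemma uniformizer_exp_nonunit (F : fieldType) (v : discreteValuation F)
    (p : integers v) (hp : uniformizer p) (r : nat) (hr : (0 < r)%N) :
  ~ exists y, p ^+ r * y = 1.
Proof.
case: hp => p0 vp; case: r hr => // r _ [y].
have pm : p \in maximal_ideal v by rewrite !unfold_in vp lexx orbT.
rewrite exprS -mulrA mulrC => /(congr1 (fun z => z \in maximal_ideal v)).
by rewrite idealr1 idealMr.
Qed.

Definition integers_mod (F : fieldType) (v : discreteValuation F)
    (p : integers v) (hp : uniformizer p) (r : nat) (hr : (0 < r)%N) :=
  {ideal_quot principal_ideal (uniformizer_exp_nonunit hp hr)}.

HB.instance Definition _ (F : fieldType) (v : discreteValuation F)
    (p : integers v) (hp : uniformizer p) (r : nat) (hr : (0 < r)%N) :=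
  GRing.ComNzRing.on (integers_mod hp hr).

Record sgraph := SGraph {
  vertex :> Type;
  adj : vertex -> vertex -> Prop;
  adj_sym : forall x y, adj x y -> adj y x;
  adj_irrefl : forall x, ~ adj x x
}.

Section Graph.
Variable G : sgraph.

Definition regular (k : nat) := forall x : G, [set y | adj x y] #= `I_k.

Definition connected := forall x y : G, clos_refl_trans G (@adj G) x y.

Definition bipartite :=
  exists c : G -> bool, forall x y : G, adj x y -> c x != c y.

Variable R : realType.

Definition adj_mx (n : nat) (e : 'I_n -> G) : 'M[R]_n :=
  \matrix_(i, j) (`[< adj (e i) (e j) >])%:R.

(* Two enumerations of the vertices give similar matrices, so neither
   definition below depends on the choice of [e]. *)
Definition adj_spectrum : set R :=
  [set a | exists n (e : 'I_n -> G), bijective e /\ eigenvalue (adj_mx e) a].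

(* [s] lists all the eigenvalues with multiplicity, in nonincreasing order. *)
Definition sorted_adj_spectrum (s : seq R) :=
  sorted >=%R s /\
  exists n (e : 'I_n -> G),
    bijective e /\ char_poly (adj_mx e) = \prod_(x <- s) ('X - x%:P).

Definition second_largest_normalized_eigenvalue (k : nat) (a : R) :=
  exists s : seq R,
    [/\ sorted_adj_spectrum s, (1 < size s)%N & a = s`_1 / k%:R].

End Graph.

Arguments adj_spectrum : clear implicits.

Definition is_submodule (A : comNzRingType) (V : lmodType A) (M : set V) :=
  submod_closed [pred x in M].

Definition is_free (A : comNzRingType) (V : lmodType A) (M : set V) :=
  exists (m : nat) (f : {linear 'rV[A]_m -> V}), injective f /\ range f = M.

Definition free_flag_vertices (A : comNzRingType) : set (set 'rV[A]_3) :=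
  [set M | [/\ is_submodule M, is_free M, M <> [set 0] & M <> setT]].

Arguments free_flag_vertices : clear implicits.

Section FreeProjectivePlane.
Variable A : comNzRingType.

Definition flag_adj (M N : free_flag_vertices A) :=
  M <> N /\ (val M `<=` val N \/ val N `<=` val M).

Lemma flag_adj_sym M N : flag_adj M N -> flag_adj N M.
Proof. by move=> [MN []] s; split; auto. Qed.

Lemma flag_adj_irrefl M : ~ flag_adj M M.
Proof. by case. Qed.

Definition free_projective_plane := SGraph flag_adj_sym flag_adj_irrefl.

End FreeProjectivePlane.

(* Main.v *)
(* Put A = O/p^r. A free submodule of A^3 other than 0 and A^3 is spanned by one
   unimodular vector or is the kernel of one unimodular functional, the
   generator being unique up to units, so the graph is two copies of a set of
   normalized unimodular vectors, with x adjacent to f when f(x) = 0. The number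
   of common neighbours of f <> g only depends on the largest d < r with f = g
   mod p^d up to units: it is q^d, while the degree is k = (q + 1) q^(r-1). With
   E_d the matrix of the relation "same side and congruent mod p^d up to units",
   the adjacency matrix M satisfies
     M^2 = E_0 + sum_(0 < d < r) (q^d - q^(d-1)) E_d + q^r E_r.
   The E_d are block matrices with constant block sizes nu_d, and
   E_d E_e = nu_e E_d for d <= e. Hence E_j (M^2 - lam_j) is a combination of
   E_0, ..., E_(j-1), where lam_0 = k^2 and lam_j = q^(2r-j) for j > 0. As E_r is
   the identity, prod_j (X^2 - lam_j) annihilates M; its roots being real and
   simple, M is diagonalizable, and differences of block indicators show that
   every root is an eigenvalue. The eigenvalue k is simple by connectedness. *)

Require Import Defs.
From HB Require Import structures.
From mathcomp Require Import all_boot all_order all_algebra.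
From mathcomp Require Import ring zify.
From Stdlib Require Import Relation_Operators.

Set Implicit Arguments.
Unset Strict Implicit.
Unset Printing Implicit Defensive.

Import Order.TTheory GRing.Theory Num.Theory.
Local Open Scope ring_scope.

(** * Finite chain rings, the abstract form of $\mathcal O/\pi^r$ *)

Record chain_ring (A : comNzRingType) (p : A) (q r : nat) : Prop := ChainRing {
  chain_gt0 : (0 < r)%N;
  chain_nil : p ^+ r = 0;
  chain_neq0 : p ^+ r.-1 != 0;
  chain_local : forall x : A, (exists y, x = p * y) \/ (exists y, x * y = 1);
  chain_residue : exists s : 'I_q -> A, (forall x, exists i y, x = s i + p * y) /\
    (forall i j y, s i = s j + p * y -> i = j)
}.

(** Expansion in digits: modulo [p ^+ m] every element is a sum of [m] digits [t i] times powers of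
    [p], and at [m = r] the remainder vanishes. This is what makes [A] finite. *)
Lemma chain_ring_enum (A : comNzRingType) (p : A) q r : chain_ring p q r ->
  exists s : seq A, forall x, x \in s.
Proof.
move=> [_ pr _ _ [t [tP _]]].
suff [s sP] : exists s : seq A, forall x, exists2 a, a \in s & exists y, x = a + p ^+ r * y.
  by exists s => x; have [a sa [y ->]] := sP x; rewrite pr mul0r addr0.
elim: (r) => [|m [s sP]].
  by exists [:: 0] => x; exists 0; rewrite ?inE //; exists x; rewrite mul1r add0r.
exists [seq a + p ^+ m * t i | a <- s, i <- enum 'I_q] => x.
have [a sa [y ->]] := sP x; have [i [z ->]] := tP y.
exists (a + p ^+ m * t i); last by exists z; rewrite exprSr; ring.
by apply: allpairs_f; rewrite ?mem_enum.
Qed.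

(* The hypothesis on [f] holds for additive maps; the codomain need not carry a
   group structure. *)
Lemma card_ker_imset (V : finZmodType) (W : finType) (f : V -> W) (S : {set V}) :
    (forall x y, (f x == f y) = (f (x - y) == f 0)) ->
    {in S &, forall x y, x - y \in S} ->
  (#|S| = #|f @: S| * #|[set x in S | f x == f 0%R]|)%N.
Proof.
move=> fB SB; rewrite -sum1_card (partition_big_imset f) /= -sum_nat_const.
apply: eq_bigr => _ /imsetP[x0 Sx0 ->]; rewrite sum1dep_card.
have SD x y : x \in S -> y \in S -> x + y \in S.
  by move=> Sx Sy; rewrite -[y]opprK SB // -sub0r SB // -(subrr x) SB.
transitivity #|[set x0 + z | z in [set x in S | f x == f 0]]|; last first.
  by rewrite card_imset //; apply: addrI.
congr #|pred_of_set _|.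
apply/setP => x; rewrite inE; apply/andP/imsetP => [[Sx fx]|[z]].
  exists (x - x0); last by rewrite addrC subrK.
  by rewrite inE SB //= -fB.
by rewrite inE => /andP[Sz fz] ->; rewrite SD // fB addrAC subrr add0r.
Qed.

(** * Divisibility by powers of [p] and the sizes of the ideals *)

Section ChainRing.
Variables (A : finComNzRingType) (p : A) (q r : nat).
Hypothesis Achain : chain_ring p q r.

Let r_gt0 : (0 < r)%N := chain_gt0 Achain.

Definition pdvd (d : nat) (x : A) := [exists y, x == p ^+ d * y].

Lemma pdvdP d x : reflect (exists y, x = p ^+ d * y) (pdvd d x).
Proof. exact: exists_eqP. Qed.

Lemma pdvd_exp d x : pdvd d (p ^+ d * x).
Proof. by apply/pdvdP; exists x. Qed.

Lemma pdvd0x x : pdvd 0 x.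
Proof. by apply/pdvdP; exists x; rewrite expr0 mul1r. Qed.

Lemma pdvd0 d : pdvd d 0.
Proof. by apply/pdvdP; exists 0; rewrite mulr0. Qed.

Lemma pdvdB d x y : pdvd d x -> pdvd d y -> pdvd d (x - y).
Proof. by move=> /pdvdP[a ->] /pdvdP[b ->]; rewrite -mulrBr pdvd_exp. Qed.

Lemma pdvdN d x : pdvd d x -> pdvd d (- x).
Proof. by rewrite -sub0r; apply: pdvdB; apply: pdvd0. Qed.

Lemma pdvdD d x y : pdvd d x -> pdvd d y -> pdvd d (x + y).
Proof. by rewrite -{2}[y]opprK => dx dy; apply: pdvdB => //; apply: pdvdN. Qed.

Lemma pdvdMl d x y : pdvd d x -> pdvd d (y * x).
Proof. by move=> /pdvdP[a ->]; rewrite mulrCA pdvd_exp. Qed.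

Lemma pdvdMr d x y : pdvd d x -> pdvd d (x * y).
Proof. by rewrite mulrC; apply: pdvdMl. Qed.

Lemma pdvdM d e x y : pdvd d x -> pdvd e y -> pdvd (d + e) (x * y).
Proof. by move=> /pdvdP[a ->] /pdvdP[b ->]; rewrite mulrACA -exprD pdvd_exp. Qed.

Lemma pdvd_sum d (I : finType) (F : I -> A) :
  (forall i, pdvd d (F i)) -> pdvd d (\sum_i F i).
Proof. by move=> dF; elim/big_ind: _ => [||i _ //]; [apply: pdvd0|apply: pdvdD]. Qed.

Lemma pdvdW d e x : (e <= d)%N -> pdvd d x -> pdvd e x.
Proof. by move=> /subnK <- /pdvdP[y ->]; rewrite addnC exprD -mulrA pdvd_exp. Qed.

Lemma expp0 d : (r <= d)%N -> p ^+ d = 0.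
Proof. by move=> /subnK <-; rewrite exprD (chain_nil Achain) mulr0. Qed.

Lemma pdvd_ge d x : (r <= d)%N -> pdvd d x = (x == 0).
Proof.
move=> rd; apply/pdvdP/eqP => [[y ->]|->]; first by rewrite expp0 ?mul0r.
by exists 0; rewrite mulr0.
Qed.

Lemma expp_neq0 d : (p ^+ d != 0) = (d < r)%N.
Proof.
case: ltnP => [dr|/expp0 ->]; last by rewrite eqxx.
apply: contraNneq (chain_neq0 Achain) => pd0.
by rewrite -(@subnK d r.-1) ?exprD ?pd0 ?mulr0 //; lia.
Qed.

(** Invertibility, in the boolean form that locality allows; [aunitP] is the equivalence. *)
Definition aunit (x : A) := ~~ pdvd 1 x.

Lemma aunitP x : reflect (exists y, x * y = 1) (aunit x).
Proof.
apply: (iffP idP) => [|[y xy]].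
  by case: (chain_local Achain x) => // -[y ->]; rewrite /aunit -{1}[p]expr1 pdvd_exp.
(* If [x = p * z] had an inverse [y], then [p ^+ r.-1 = p ^+ r.-1 * x * y = p ^+ r * z * y = 0]. *)
apply/negP => /pdvdP[z xE]; have /eqP := chain_neq0 Achain; apply.
rewrite -[LHS]mulr1 -xy xE mulrA expr1 mulrA -exprSr prednK //.
by rewrite (chain_nil Achain) !mul0r.
Qed.

Lemma aunit1 : aunit 1.
Proof. by apply/aunitP; exists 1; rewrite mulr1. Qed.

Lemma aunitM x y : aunit (x * y) = aunit x && aunit y.
Proof.
apply/aunitP/andP => [[z xyz]|[/aunitP[x' xx'] /aunitP[y' yy']]].
  split; apply/aunitP; first by exists (y * z); rewrite mulrA.
  by exists (x * z); rewrite mulrCA mulrA.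
by exists (x' * y'); rewrite mulrACA xx' yy' mulr1.
Qed.

Lemma aunit_mulI x : aunit x -> injective ( *%R x).
Proof.
move=> /aunitP[y xy] a b /(congr1 ( *%R y)).
by rewrite !mulrA [y * x]mulrC xy !mul1r.
Qed.

Lemma pdvd_unitM d x y : aunit x -> pdvd d (x * y) = pdvd d y.
Proof.
move=> /aunitP[z xz]; apply/idP/idP; last exact: pdvdMl.
by move=> /(pdvdMl z); rewrite mulrA [z * x]mulrC xz mul1r.
Qed.

Lemma aunitD x y : pdvd 1 y -> aunit (x + y) = aunit x.
Proof.
move=> y1; congr (~~ _); apply/idP/idP => [xy1|/pdvdD]; last by apply.
by rewrite -(addrK y x) pdvdB.
Qed.

Lemma aunitB x y : pdvd 1 y -> aunit (x - y) = aunit x.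
Proof. by move=> /pdvdN; apply: aunitD. Qed.

(** Factors [p] are extracted until a unit is left; after [r] of them only [0] remains. *)
Lemma chain_decomp x : x = 0 \/ exists j u, [/\ (j < r)%N, aunit u & x = p ^+ j * u].
Proof.
suff H n : (exists y, x = p ^+ n * y) \/
    (exists j u, [/\ (j < n)%N, aunit u & x = p ^+ j * u]).
  case: (H r) => [[y ->]|]; last by right.
  by left; rewrite expp0 ?mul0r.
elim: n => [|n [[y xE]|[j [u [jn uu xE]]]]].
- by left; exists x; rewrite expr0 mul1r.
- have [/pdvdP[z yE]|uy] := boolP (pdvd 1 y).
    by left; exists z; rewrite xE yE mulrA -exprD addn1.
  by right; exists n, y.
- by right; exists j, u; split=> //; apply: ltnW.
Qed.

(** On [x = p ^+ j * u] with [u] a unit, the product vanishes exactly when [d + j >= r]. *)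
Lemma expp_eq0 d x : (p ^+ d * x == 0) = pdvd (r - d) x.
Proof.
case: (chain_decomp x) => [->|[j [u [jr uu xE]]]].
  by rewrite mulr0 eqxx pdvd0.
have [y uy] := aunitP u uu.
apply/eqP/idP => [|/pdvdP[z ->]]; last first.
  by rewrite mulrA -exprD expp0 ?mul0r //; lia.
rewrite xE mulrA -exprD => /(congr1 ( *%R^~ y)); rewrite -mulrA uy mul0r mulr1.
by move/eqP; rewrite -[_ == _]negbK expp_neq0 => dj; apply/(pdvdW _ (pdvd_exp j u)); lia.
Qed.

(** Multiplication by [p] maps $p^dA$ onto $p^{d+1}A$ with kernel $p^{r-1}A$. *)
Lemma card_pdvd_step d : (d < r)%N ->
  #|pdvd d| = (#|pdvd d.+1| * #|pdvd r.-1|)%N.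
Proof.
move=> dr; have := @card_ker_imset A A ( *%R p) [set x | pdvd d x].
rewrite cardsE => ->.
- congr (_ * _)%N.
    rewrite -cardsE; apply: eq_card => x; rewrite inE.
    apply/imsetP/pdvdP => [[y]|[y ->]].
      by rewrite inE => /pdvdP[z ->] ->; exists z; rewrite exprS mulrA.
    by exists (p ^+ d * y); rewrite ?inE ?pdvd_exp // exprS mulrA.
  rewrite -cardsE; apply: eq_card => x; rewrite !inE mulr0 -{1}[p]expr1 expp_eq0 subn1.
  by rewrite andb_idl //; apply: pdvdW; lia.
- by move=> x y; rewrite mulr0 mulrBr subr_eq0.
- by move=> x y; rewrite !inE; apply: pdvdB.
Qed.

Lemma card_chain_pdvd1 : #|A| = (q * #|pdvd 1|)%N.
Proof.
have [s [sP sI]] := chain_residue Achain.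
pose f (w : 'I_q * A) := s w.1 + w.2.
have fI : {in setX [set: 'I_q] [set x | pdvd 1 x] &, injective f}.
  move=> [i x] [j y]; rewrite !inE /f /= => /pdvdP[x' ->] /pdvdP[y' ->] E.
  have ij : i = j by apply: (sI i j (y' - x')); rewrite mulrBr addrA -E addrK.
  by move: E; rewrite ij => /addrI ->.
rewrite -[in RHS](card_ord q) -[#|'I_q|]cardsT -[#|pdvd 1|]cardsE -cardsX -(card_in_imset fI).
apply: eq_card => x; rewrite !inE; apply/esym/imsetP.
have [i [y ->]] := sP x; exists (i, p * y) => //.
by rewrite !inE -{1}[p]expr1 pdvd_exp.
Qed.

(** Both $q$ and $|p^{r-1}A|$ are the ratio of $|A|$ to $|pA|$, by the residue representatives and
    by the step at [d = 0]. *)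
Lemma card_pdvd_last : #|pdvd r.-1| = q.
Proof.
have := card_pdvd_step r_gt0; rewrite mulnC.
have -> : #|pdvd 0| = #|A| by apply: eq_card => x; apply: pdvd0x.
rewrite card_chain_pdvd1 => /eqP; rewrite eqn_pmul2r => [/eqP->//|].
by apply/card_gt0P; exists 0; apply: pdvd0.
Qed.

Lemma card_pdvd d : #|pdvd d| = (q ^ (r - d))%N.
Proof.
have H m : (m <= r)%N -> #|pdvd (r - m)| = (q ^ m)%N.
  elim: m => [_|m IHm mr].
    rewrite subn0 expn0 -(card1 (0 : A)); apply: eq_card => x.
    by rewrite !inE [LHS]pdvd_ge.
  rewrite card_pdvd_step; last by lia.
  by rewrite card_pdvd_last -subSn // subSS IHm ?expnSr //; lia.
have [dr|rd] := leqP d r; first by rewrite -{1}(subKn dr) H // leq_subr.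
have -> : (r - d = 0)%N by lia.
rewrite -(H 0%N) // subn0; apply: eq_card => x.
by rewrite -!topredE /= !pdvd_ge // ltnW.
Qed.

Lemma card_chain : #|A| = (q ^ r)%N.
Proof. by rewrite -[r]subn0 -card_pdvd; apply: eq_card => x; rewrite [RHS]pdvd0x. Qed.

(** The ideal $pA$ misses [1], so $q^{r-1}<q^r$, which rules out $q=0$ and $q=1$. *)
Lemma q_gt1 : (1 < q)%N.
Proof.
have : [set x | pdvd 1 x] \proper [set: A].
  apply/properP; split; first exact: subsetT.
  by exists 1; rewrite !inE //; apply: aunit1.
move/proper_card; rewrite cardsE card_pdvd cardsT card_chain.
case: q => [|[|//]]; last by rewrite !exp1n.
by rewrite [X in (_ < X)%N]exp0n.
Qed.

Lemma card_aunit : #|aunit| = (q ^ r - q ^ r.-1)%N.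
Proof.
have := cardC (pdvd 1); rewrite card_pdvd card_chain subn1 => <-.
by rewrite addKn; apply: eq_card => x; rewrite !inE.
Qed.

(** * The bilinear form on $A^3$ and systems of two equations *)

Local Notation V := 'rV[A]_3.

(** Functionals on $A^3$ are represented by vectors through this form, so that points and lines are
    parametrized by the same set. *)
Definition dot (x y : V) : A := \sum_i x 0 i * y 0 i.

Lemma dotC x y : dot x y = dot y x.
Proof. by apply: eq_bigr => i _; rewrite mulrC. Qed.

Lemma dotDr x y z : dot x (y + z) = dot x y + dot x z.
Proof. by rewrite -big_split; apply: eq_bigr => i _; rewrite mxE mulrDr. Qed.

Lemma dotZr a x y : dot x (a *: y) = a * dot x y.
Proof. by rewrite mulr_sumr; apply: eq_bigr => i _; rewrite mxE mulrCA. Qed.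

Lemma dotBr x y z : dot x (y - z) = dot x y - dot x z.
Proof. by rewrite dotDr -scaleN1r dotZr mulN1r. Qed.

Lemma dotZl a x y : dot (a *: x) y = a * dot x y.
Proof. by rewrite dotC dotZr dotC. Qed.

Lemma dot_delta x i : dot x (delta_mx 0 i) = x 0 i.
Proof.
rewrite /dot (bigD1 i) //= mxE !eqxx mulr1 big1 ?addr0 // => j ji.
by rewrite mxE (negPf ji) andbF mulr0.
Qed.

Definition vdvd d (x : V) := [forall i, pdvd d (x 0 i)].

Lemma vdvdP d x : reflect (exists y, x = p ^+ d *: y) (vdvd d x).
Proof.
apply: (iffP forallP) => [dx|[y -> i]]; last by rewrite mxE pdvd_exp.
have /fin_all_exists[y yE] i : exists y, x 0 i = p ^+ d * y by apply/pdvdP.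
by exists (\row_i y i); apply/rowP => i; rewrite !mxE.
Qed.

Lemma vdvdB d x y : vdvd d x -> vdvd d y -> vdvd d (x - y).
Proof.
by move=> /forallP dx /forallP dy; apply/forallP => i; rewrite !mxE pdvdB.
Qed.

Lemma vdvd_dot d e x y : vdvd d x -> vdvd e y -> pdvd (d + e) (dot x y).
Proof.
by move=> /forallP dx /forallP ey; apply: pdvd_sum => i; apply: pdvdM.
Qed.

Lemma card_vdvd d : #|vdvd d| = (q ^ (3 * (r - d)))%N.
Proof.
have := @card_ffun_on 'I_3 A (pdvd d).
rewrite card_ord card_pdvd mulnC expnM => <-.
have fI : injective (fun x : V => [ffun i => x 0 i]).
  by move=> x y /ffunP xy; apply/rowP => i; have := xy i; rewrite !ffunE.
rewrite -(card_image fI); apply: eq_card => f; apply/imageP/ffun_onP.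
  by move=> [x /forallP dx -> i]; rewrite ffunE; apply: dx.
move=> df; exists (\row_i f i); last by apply/ffunP => i; rewrite ffunE mxE.
by apply/forallP => i; rewrite mxE; apply: df.
Qed.

Definition minor (f h : V) i l := f 0 i * h 0 l - f 0 l * h 0 i.

Lemma dot_onto f h i l a b : aunit (minor f h i l) ->
  exists z, dot f z = a /\ dot h z = b.
Proof.
move=> /aunitP[y my].
(* Cramer's rule on the coordinates [i] and [l], with [y] the inverse of the minor. *)
exists ((y * (a * h 0 l - b * f 0 l)) *: delta_mx 0 i +
        (y * (f 0 i * b - h 0 i * a)) *: delta_mx 0 l).
rewrite !dotDr !dotZr !dot_delta; split.
  by rewrite -[RHS]mulr1 -my /minor; ring.
by rewrite -[RHS]mulr1 -my /minor; ring.
Qed.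

(* Solutions of a pair of equations in standard position, counted as the kernel
   of [y |-> (f y, p^d h y)] on [p^e A^3], whose image is [p^e A * p^(d+e) A]. *)
Lemma card_dot2 f h d e i l : aunit (minor f h i l) ->
  (#|[pred y | [&& vdvd e y, dot f y == 0%R & (p ^+ d * dot h y)%R == 0%R]]|
    * q ^ (r - e + (r - (d + e))) = q ^ (3 * (r - e)))%N.
Proof.
move=> mu; pose F (y : V) : A * A := (dot f y, p ^+ d * dot h y).
have F0 : F 0 = (0, 0) by rewrite /F -(scale0r 0) !dotZr !mul0r mulr0.
have := @card_ker_imset V _ F [set y | vdvd e y].
rewrite cardsE card_vdvd => -> //.
- rewrite mulnC; congr (_ * _)%N; last first.
    by rewrite -cardsE; apply: eq_card => y; rewrite !inE F0 -pair_eqE.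
  have -> : F @: [set y | vdvd e y] = setX [set x | pdvd e x] [set x | pdvd (d + e) x].
    apply/setP => -[a b]; rewrite !inE; apply/imsetP/andP => /= [[y]|].
      rewrite inE => ey [-> ->]; have v0 g : vdvd 0 g by apply/forallP => j; apply: pdvd0x.
      split; first exact: (vdvd_dot (v0 f) ey).
      by have := pdvdM (pdvd_exp d 1) (vdvd_dot (v0 h) ey); rewrite mulr1.
    move=> [/pdvdP[a' ->] /pdvdP[b' ->]].
    have [z [fz hz]] := dot_onto a' b' mu; exists (p ^+ e *: z).
      by rewrite inE; apply/vdvdP; exists z.
    by rewrite /F !dotZr fz hz mulrA -exprD.
  by rewrite cardsX !cardsE !card_pdvd expnD.
- by move=> x y; rewrite F0 /F -!pair_eqE /= !dotBr mulrBr !subr_eq0.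
- by move=> x y; rewrite !inE; apply: vdvdB.
Qed.

(** * Unimodular vectors and their normalized representatives *)

Definition unimodular (x : V) := ~~ vdvd 1 x.

Lemma unimodularP (x : V) : reflect (exists i, aunit (x 0 i)) (unimodular x).
Proof. by rewrite /unimodular negb_forall; apply: existsP. Qed.

Lemma unimodularZ u x : aunit u -> unimodular (u *: x) = unimodular x.
Proof.
move=> uu; rewrite /unimodular /vdvd; congr (~~ _).
by apply: eq_forallb => i; rewrite mxE pdvd_unitM.
Qed.

(* The representative of a line spanned by a unimodular vector whose first
   invertible entry is [1]. *)
Definition normal_at (x : V) (i : 'I_3) :=
  (x 0 i == 1) && [forall j : 'I_3, (j < i)%N ==> pdvd 1 (x 0 j)].

Definition normalized x := [exists i, normal_at x i].

Lemma normal_atP (x : V) i :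
  reflect (x 0 i = 1 /\ forall j : 'I_3, (j < i)%N -> pdvd 1 (x 0 j)) (normal_at x i).
Proof.
apply: (iffP andP) => -[/eqP xi xj]; split=> //.
  by move=> j; apply/implyP/(forallP xj).
by apply/forallP => j; apply/implyP/xj.
Qed.

Lemma normalized_unimodular x : normalized x -> unimodular x.
Proof.
by move=> /existsP[i /normal_atP[xi _]]; apply/unimodularP; exists i; rewrite xi aunit1.
Qed.

Lemma normalize x : unimodular x ->
  exists u y, [/\ aunit u, normalized y & x = u *: y].
Proof.
move=> /unimodularP[i0 xi0].
(* Division by the first invertible entry: minimality of [i] puts all earlier entries in the maximal
   ideal. *)
case: (@arg_minnP _ i0 (fun i => aunit (x 0 i)) (fun i : 'I_3 => i : nat) xi0) => i xi imin.
have [y xy] := aunitP _ xi.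
exists (x 0 i), (y *: x); split=> //; last by rewrite scalerA xy scale1r.
apply/existsP; exists i; apply/normal_atP; split; first by rewrite mxE mulrC.
move=> j ji; rewrite mxE; apply: pdvdMl; rewrite -[pdvd _ _]negbK; apply/negP => /imin.
by rewrite leqNgt ji.
Qed.

(** The position of the leading [1] can be read off modulo [p]. *)
Lemma normal_at_congr x y i j : vdvd 1 (x - y) ->
  normal_at x i -> normal_at y j -> i = j.
Proof.
move=> /forallP xy /normal_atP[xi xlt] /normal_atP[yj ylt]; apply: ord_inj.
have /[!mxE] xyi := xy i; have /[!mxE] xyj := xy j.
case: (ltngtP i j) => // [ij|ji].
  by have := pdvdD xyi (ylt _ ij); rewrite subrK xi (negPf aunit1).
by have := pdvdB (xlt _ ji) xyj; rewrite subKr yj (negPf aunit1).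
Qed.

(** Scaling by a unit preserves the first invertible position; the entry [1] found there on both
    sides then identifies the two units. *)
Lemma normalized_scale u u' x y : aunit u -> aunit u' ->
  normalized x -> normalized y -> u *: x = u' *: y -> u = u' /\ x = y.
Proof.
move=> uu uu' /existsP[i nx] /existsP[j ny] E.
have Ei k : u * x 0 k = u' * y 0 k by have /rowP/(_ k) := E; rewrite !mxE.
have [[xi xlt] [yj ylt]] := (normal_atP _ _ nx, normal_atP _ _ ny).
have ij : i = j.
  apply: ord_inj; case: (ltngtP i j) => // [ij|ji].
    have := ylt _ ij; rewrite -(pdvd_unitM 1 (y 0 i) uu') -Ei xi mulr1.
    by move=> H; move: uu; rewrite /aunit H.
  have := xlt _ ji; rewrite -(pdvd_unitM 1 (x 0 j) uu) Ei yj mulr1.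
  by move=> H; move: uu'; rewrite /aunit H.
have uE : u = u' by have := Ei i; rewrite {2}ij xi yj !mulr1.
by split=> //; apply/rowP => k; have := Ei k; rewrite uE => /(aunit_mulI uu').
Qed.

(** The units act freely on unimodular vectors, and the normalized ones form a transversal of the
    orbits. *)
Lemma card_normalized (Q : pred V) :
    (forall u y, aunit u -> Q (u *: y) = Q y) ->
  (#|aunit| * #|[pred y | normalized y && Q y]| =
   #|[pred y | unimodular y && Q y]|)%N.
Proof.
move=> QZ; pose S := setX [set u | aunit u] [set y | normalized y && Q y].
have <- : #|S| = (#|aunit| * #|[pred y | normalized y && Q y]|)%N.
  by rewrite cardsX !cardsE.
rewrite -(@card_in_imset _ _ (fun w : A * V => w.1 *: w.2)).
  apply: eq_card => x; rewrite !inE; apply/imsetP/andP => [[[u y]]|[ux Qx]].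
    rewrite !inE /= => /and3P[uu ny Qy] ->.
    by rewrite unimodularZ // QZ // normalized_unimodular.
  have [u [y [uu ny xE]]] := normalize ux; exists (u, y) => //.
  by rewrite !inE /= uu ny -(QZ u) // -xE.
move=> [u y] [u' y']; rewrite !inE /= => /and3P[uu ny _] /and3P[uu' ny' _] E.
by have [-> ->] := normalized_scale uu uu' ny ny' E.
Qed.

(** On normalized vectors, congruence modulo $p^d$ up to units is plain congruence, as the leading
    entries [1] force the unit to be $1$ modulo $p^d$. At [d = 0] the relation computes to [true],
    so that a whole side is one class. *)
Definition congr_at d (x y : V) := (d == 0%N) || vdvd d (x - y).

(** On the kernel of [f], the equation of [g] becomes [p ^+ d * dot h y = 0] with [f] and [h]
    independent modulo [p]: the standard position required by [card_dot2]. *)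
Lemma normalized_minor d f g : normalized f -> normalized g ->
    congr_at d f g -> ~~ congr_at d.+1 f g ->
  exists c h i l, g = c *: f + p ^+ d *: h /\ aunit (minor f h i l).
Proof.
move=> /existsP[i nf] /existsP[j ng]; rewrite {2}/congr_at /= => fgd.
rewrite negb_forall => /existsP[l fgl].
have [[fi flt] [gj glt]] := (normal_atP _ _ nf, normal_atP _ _ ng).
have [fg1|fg1] := boolP (vdvd 1 (f - g)).
  have ij := normal_at_congr fg1 nf ng; subst j.
  have : vdvd d (f - g).
    case/orP: fgd => // /eqP->; apply/forallP => k; apply: pdvd0x.
  (* The quotient of [g - f] by [p ^+ d] is corrected to vanish at [i]; this changes nothing after
     multiplication by [p ^+ d], because [f] and [g] both have entry [1] there. The minor at [i],
     [l] is then [- h 0 l], a unit since [f] and [g] differ at [l] modulo [p ^+ d.+1]. *)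
  move=> /vdvdP[h hE]; exists 1, (- h + (h 0 i) *: delta_mx 0 i), i, l.
  have phi : p ^+ d * h 0 i = 0.
    by have /rowP/(_ i) := hE; rewrite !mxE fi gj subrr.
  split.
    rewrite scale1r scalerDr scalerN -hE scalerA phi scale0r addr0.
    by rewrite opprB addrC subrK.
  have il : l != i.
    by apply: contraNneq fgl => ->; rewrite !mxE fi gj subrr pdvd0.
  rewrite /minor !mxE fi !eqxx (negPf il) /= mul1r mulr1 addNr !mulr0 addr0 subr0.
  apply: contraNN fgl => /pdvdP[z hz]; have /rowP/(_ l) := hE; rewrite mxE [RHS]mxE => ->.
  by rewrite -[h 0 l]opprK hz mulrN mulrA -exprD addn1 pdvdN ?pdvd_exp.
have {fgd} d0 : d = 0%N.
  case/orP: fgd => [/eqP//|]; case: d {fgl} => // d /(forallP) fgd.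
  case/negP: fg1; apply/forallP => k; exact: pdvdW (fgd k).
(* With [d = 0] the vector [g] itself serves as [h]. If the leading positions differ, the minor
   there is [1] up to a multiple of [p], or up to sign; if they coincide, it is [g 0 l - f 0 l]. *)
subst d; exists 0, g; rewrite scale0r add0r expr0 scale1r /minor.
have [ij|ij|ij] := ltngtP i j.
- exists i, j; split=> //; rewrite fi gj mulr1 aunitB ?aunit1 //.
  by apply: pdvdMl; apply: glt.
- exists i, j; split=> //; rewrite fi gj mulr1 aunitB ?aunit1 //.
  by apply: pdvdMr; apply: flt.
- have {}ij : i = j by apply: ord_inj.
  subst j; exists i, l; split=> //; rewrite fi gj mul1r mulr1.
  by move: fgl; rewrite !mxE -/(aunit _) -opprB -mulN1r aunitM => /andP[].
Qed.

(** * Counting points, neighbours, common neighbours and congruence classes *)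

Lemma expn_cancel N a b : (N * q ^ a = q ^ (a + b))%N -> N = (q ^ b)%N.
Proof.
rewrite mulnC expnD => /eqP; rewrite eqn_pmul2l => [/eqP//|].
by rewrite expn_gt0 (ltnW q_gt1).
Qed.

Lemma unimodular_minor f : unimodular f -> exists h i l, aunit (minor f h i l).
Proof.
move=> /unimodularP[i fi]; pose l : 'I_3 := if i == 0 then 1 else 0.
have il : i != l by rewrite /l; have [->|] := eqVneq i 0.
exists (delta_mx 0 l), i, l.
by rewrite /minor !mxE !eqxx (negPf il) /= mulr1 mulr0 subr0.
Qed.

(** The case [d = r] of [card_dot2], where the second equation holds because [p ^+ r = 0];
    [unimodular_minor] supplies an auxiliary [h]. *)
Lemma card_dot1 f e : unimodular f ->
  #|[pred y | vdvd e y && (dot f y == 0)]| = (q ^ (2 * (r - e)))%N.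
Proof.
move=> /unimodular_minor[h [i [l mu]]]; have := card_dot2 r e mu.
have -> : (r - e + (r - (r + e)) = r - e)%N by lia.
have -> : (3 * (r - e) = r - e + 2 * (r - e))%N by lia.
move=> /expn_cancel <-; apply: eq_card => y; rewrite !inE.
by rewrite expp0 // mul0r eqxx andbT.
Qed.

(** Unimodular solutions are all solutions minus those in $pA^3$. Writing [vdvd 0] gives both counts
    the same shape. *)
Lemma card_normalized_split (Q : pred V) :
    (forall u y, aunit u -> Q (u *: y) = Q y) ->
  ((q ^ r - q ^ r.-1) * #|[pred y | normalized y && Q y]| =
   #|[pred y | vdvd 0 y && Q y]| - #|[pred y | vdvd 1 y && Q y]|)%N.
Proof.
move=> QZ; rewrite -card_aunit card_normalized //.
have := cardID (vdvd 1) Q.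
have -> : #|[predI Q & vdvd 1]| = #|[pred y | vdvd 1 y && Q y]|.
  by apply: eq_card => y; rewrite !inE andbC.
have -> : #|[pred y | vdvd 0 y && Q y]| = #|Q|.
  apply: eq_card => y; rewrite !inE andb_idl // => _.
  by apply/forallP => j; apply: pdvd0x.
by move=> <-; rewrite addKn; apply: eq_card => y; rewrite !inE.
Qed.

Lemma r_pred : exists s, r = s.+1.
Proof. by exists r.-1; rewrite prednK. Qed.

Lemma card_points : #|normalized| = ((q ^ 2 + q + 1) * q ^ (2 * (r - 1)))%N.
Proof.
have := @card_normalized_split predT (fun _ _ _ => erefl).
have -> : #|[pred y | normalized y && predT y]| = #|normalized|.
  by apply: eq_card => y; rewrite !inE andbT.
have vE d : #|[pred y | vdvd d y && predT y]| = (q ^ (3 * (r - d)))%N.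
  by rewrite -card_vdvd; apply: eq_card => y; rewrite !inE andbT.
rewrite !vE; have [s ->] := r_pred.
have -> : (3 * (s.+1 - 0) = s + s + s + 3)%N by lia.
have -> : (3 * (s.+1 - 1) = s + s + s)%N by lia.
have -> : (2 * (s.+1 - 1) = s + s)%N by lia.
rewrite /= expnSr !expnD.
have qs : (0 < q ^ s)%N by rewrite expn_gt0 (ltnW q_gt1).
move: #|_| (q ^ s)%N qs => X a a0 E; have q1 := q_gt1.
(* The number of units $q^r-q^{r-1}$, written as $(q-1)q^{r-1}$, is cancelled. *)
apply/eqP; rewrite -(@eqn_pmul2l ((q - 1) * a)) ?muln_gt0 ?a0 ?andbT; last by lia.
by apply/eqP; nia.
Qed.

Lemma card_degree f : unimodular f ->
  #|[pred y | normalized y && (dot f y == 0)]| = ((q + 1) * q ^ (r - 1))%N.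
Proof.
move=> uf; have QZ u y : aunit u -> (dot f (u *: y) == 0) = (dot f y == 0).
  by move=> /aunit_mulI uI; rewrite dotZr -[RHS](inj_eq uI) mulr0.
have := card_normalized_split QZ; rewrite !card_dot1 //.
have [s ->] := r_pred; rewrite /= subn0 subn1 /= mulnS expnD expnSr mul2n -addnn expnD.
have qs : (0 < q ^ s)%N by rewrite expn_gt0 (ltnW q_gt1).
move: #|_| (q ^ s)%N qs => X a a0 E; have q1 := q_gt1.
apply/eqP; rewrite -(@eqn_pmul2l ((q - 1) * a)) ?muln_gt0 ?a0 ?andbT; last by lia.
by apply/eqP; nia.
Qed.

(** After [normalized_minor], the solutions in $p^eA^3$ number $q^{r+d-e}$ for $e=0,1$, so the count
    times $q^r-q^{r-1}$ equals $q^{r+d}-q^{r+d-1}$. *)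
Lemma card_common d f g : (d < r)%N -> normalized f -> normalized g ->
    congr_at d f g -> ~~ congr_at d.+1 f g ->
  #|[pred y | normalized y && ((dot f y == 0) && (dot g y == 0))]| = (q ^ d)%N.
Proof.
move=> dr nf ng cd cd1; have [c [h [i [l [gE mu]]]]] := normalized_minor nf ng cd cd1.
have QE y : (dot f y == 0) && (dot g y == 0) = (dot f y == 0) && (p ^+ d * dot h y == 0).
  case: eqP => //= fy; congr (_ == _); rewrite gE !(dotC _ y) dotDr !dotZr.
  by rewrite -(dotC f) fy mulr0 add0r.
have QZ u y : aunit u ->
    (dot f (u *: y) == 0) && (dot g (u *: y) == 0) = (dot f y == 0) && (dot g y == 0).
  move=> /aunit_mulI uI; rewrite !dotZr.
  by rewrite -[in RHS](inj_eq uI) mulr0 -[X in _ = _ && X](inj_eq uI) mulr0.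
have := card_normalized_split QZ.
(* The bounds [e <= 1] and [d < r] give [d + e <= r], so the truncated subtraction in [card_dot2] is
   exact. *)
have K e : (e <= 1)%N ->
    #|[pred y | vdvd e y && ((dot f y == 0) && (dot g y == 0))]| = (q ^ (r + d - e))%N.
  move=> e1; have := card_dot2 d e mu.
  have -> : (3 * (r - e) = r - e + (r - (d + e)) + (r + d - e))%N by lia.
  by move=> /expn_cancel <-; apply: eq_card => y; rewrite !inE QE.
rewrite !K //; have [s ->] := r_pred.
have -> : (s.+1 + d - 0 = s + d + 1)%N by lia.
have -> : (s.+1 + d - 1 = s + d)%N by lia.
rewrite /= expnSr !expnD expn1.
have qs : (0 < q ^ s)%N by rewrite expn_gt0 (ltnW q_gt1).
move: #|_| (q ^ s)%N (q ^ d)%N qs => X a b a0 E; have q1 := q_gt1.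
apply/eqP; rewrite -(@eqn_pmul2l ((q - 1) * a)) ?muln_gt0 ?a0 ?andbT; last by lia.
by apply/eqP; nia.
Qed.

(** With [i] the leading position of [x], the map sending [y] to [x - y] carries the class to the
    vectors of $p^dA^3$ vanishing at [i], which [card_dot1] counts. *)
Lemma card_class d x : (0 < d)%N -> normalized x ->
  #|[pred y | normalized y && vdvd d (x - y)]| = (q ^ (2 * (r - d)))%N.
Proof.
move=> d0 /existsP[i nx]; have [xi xlt] := normal_atP _ _ nx.
have uE : unimodular (delta_mx 0 i).
  by apply/unimodularP; exists i; rewrite mxE !eqxx aunit1.
have sI : injective (fun y => x - y) by move=> y z /addrI /oppr_inj.
rewrite -(card_dot1 d uE) -[LHS](card_image sI).
apply: eq_card => z; rewrite [RHS]inE; apply/imageP/andP => [[y]|[dz zi]].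
    rewrite inE => /andP[/existsP[j ny] dxy] ->; split=> //.
    have ij := normal_at_congr _ nx ny; rewrite -{}ij in ny.
      rewrite dotC dot_delta !mxE xi.
      by have [-> _] := normal_atP _ _ ny; rewrite subrr.
    by apply/forallP => k; apply: pdvdW (forallP dxy k).
  exists (x - z); last by rewrite subKr.
  rewrite inE subKr dz andbT; apply/existsP; exists i; apply/normal_atP.
  move: zi; rewrite dotC dot_delta => /eqP zi; split; first by rewrite !mxE xi zi subr0.
  move=> j ji; rewrite !mxE; apply: pdvdB; first exact: xlt.
  by apply: pdvdW (forallP dz j).
Qed.

End ChainRing.

(** * Graphs with a nested chain of block relations *)

Lemma char_poly_sim (F : fieldType) n (P M D : 'M[F]_n) :
  P \in unitmx -> P *m M = D *m P -> char_poly M = char_poly D.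
Proof.
move=> Pu PM; have : map_mx polyC P *m char_poly_mx M = char_poly_mx D *m map_mx polyC P.
  rewrite /char_poly_mx mulmxBr mulmxBl -!map_mxM PM; congr (_ - _).
  by rewrite scalar_mxC.
move/(congr1 determinant); rewrite !det_mulmx mulrC; apply: mulIf.
rewrite det_map_mx polyC_eq0 -unitfE; exact: Pu.
Qed.

Definition degree q r := ((q + 1) * q ^ (r - 1))%N.

(** The size $\nu_d$ of a congruence class of normalized vectors modulo $p^d$; at [d = 0] the class
    is a whole side. *)
Definition block_size q r d :=
  if d is 0 then ((q ^ 2 + q + 1) * q ^ (2 * (r - 1)))%N else (q ^ (2 * (r - d)))%N.

(* The number of common neighbours of two vertices only depends on their
   position in the decreasing chain [E 0, ..., E r] of equivalence relations;
   the classes of [E 0] are the two sides of the bipartition. *)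
Record block_graph (n q r : nat) (adj : rel 'I_n) (E : nat -> rel 'I_n) : Prop :=
  BlockGraph {
    block_q_gt1 : (1 < q)%N;
    block_r_gt0 : (0 < r)%N;
    block_refl : forall d, reflexive (E d);
    block_sym : forall d, symmetric (E d);
    block_trans : forall d, transitive (E d);
    block_nested : forall d x y, E d.+1 x y -> E d x y;
    block_last : forall x y, E r x y = (x == y);
    card_block : forall d x, #|E d x| = block_size q r d;
    block_adj_sym : symmetric adj;
    block_adj : forall x y, adj x y -> ~~ E 0 x y;
    block_common0 : forall x y z, adj x z -> adj z y -> E 0 x y;
    block_common : forall d x y, (d < r)%N -> E d x y -> ~~ E d.+1 x y ->
      #|[pred z | adj x z && adj z y]| = (q ^ d)%N;
    block_degree : forall x, #|adj x| = degree q r;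
    block_connected : forall (S : pred 'I_n) x, S x ->
      (forall y z, S y -> adj y z -> S z) -> forall y, S y
  }.

(** The squares $\lambda_j$ of the eigenvalues: the squared degree, then $q^{2r-1}$ down to $q^r$ as
    [j] runs from [1] to [r]. *)
Definition block_eigenvalue q r j :=
  if j is 0 then (degree q r ^ 2)%N else (q ^ (2 * r - j))%N.

(** * The spectrum of a block graph *)

Section BlockSpectrum.
Variables (R : rcfType) (n' q r : nat).
Let n := n'.+1.
Variables (adj : rel 'I_n) (E : nat -> rel 'I_n).
Hypothesis BG : block_graph q r adj E.

Let k := degree q r.
Let nu := block_size q r.
Let lam := block_eigenvalue q r.
Let q_gt1 : (1 < q)%N := block_q_gt1 BG.
Let r_gt0 : (0 < r)%N := block_r_gt0 BG.
Let E_refl := block_refl BG.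
Let E_sym := block_sym BG.
Let E_trans := @block_trans _ _ _ _ _ BG.
Let E_nested := @block_nested _ _ _ _ _ BG.
Let E_last := block_last BG.
Let card_E : forall d x, #|E d x| = nu d := card_block BG.
Let adj_sym := block_adj_sym BG.
Let adj_E0 := block_adj BG.
Let common0 := block_common0 BG.
Let commond := block_common BG.
Let card_adj : forall x, #|adj x| = k := block_degree BG.
Let adj_connected := block_connected BG.

Let M : 'M[R]_n := \matrix_(i, j) (adj i j)%:R.
Let Em d : 'M[R]_n := \matrix_(i, j) (E d i j)%:R.

(* Chosen so that [c 0 + ... + c d] is the number of common neighbours of two
   vertices related by [E d] but not by [E d.+1]: [q ^ d] if [d < r], and the
   degree if [d = r]. *)
Definition block_coef d : R :=
  if d is d'.+1 then if d == r then q%:R ^+ r else q%:R ^+ d - q%:R ^+ d' else 1.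

Let c := block_coef.

Lemma E_le d e x y : (d <= e)%N -> E e x y -> E d x y.
Proof. by move=> /subnK <-; elim: (e - d)%N => // m IH /E_nested. Qed.

Lemma sum_pred (P : pred 'I_n) : \sum_z (P z)%:R = #|P|%:R :> R.
Proof.
rewrite -sum1_card natr_sum [RHS]big_mkcond; apply: eq_bigr => z _.
by rewrite -topredE /=; case: (P z).
Qed.

(** The entry at [x], [y] counts the intersection of the [E d] class of [x] with the [E j] class of
    [y]; by nestedness the latter is contained in the former or disjoint from it. *)
Lemma mulEr d j : (d <= j)%N -> Em d *m Em j = (nu j)%:R *: Em d.
Proof.
move=> dj; apply/matrixP => x y; rewrite !mxE.
under eq_bigr do rewrite !mxE -natrM mulnb.
rewrite (sum_pred (fun z => E d x z && E j z y)) -natrM; congr _%:R.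
have [xy|xy] := boolP (E d x y); last first.
  rewrite muln0; apply: eq_card0 => z; rewrite inE; apply/negP => /andP[xz].
  by move=> /(E_le dj) zy; case/negP: xy; apply: E_trans zy.
rewrite muln1 -(card_E j y); apply: eq_card => z; rewrite [LHS]inE [RHS]E_sym.
by rewrite andb_idl // => /(E_le dj); rewrite E_sym; apply: E_trans.
Qed.

Lemma mulEl d j : (d <= j)%N -> Em j *m Em d = (nu j)%:R *: Em d.
Proof.
have tE e : (Em e)^T = Em e by apply/matrixP => x y; rewrite !mxE E_sym.
by move=> /mulEr/(congr1 trmx); rewrite trmx_mul linearZ /= !tE.
Qed.

Lemma sum_coef m : (m < r)%N -> \sum_(i < m.+1) c i = q%:R ^+ m.
Proof.
elim: m => [|m IH] mr; first by rewrite big_ord1.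
by rewrite big_ord_recr /= IH 1?ltnW // (ltn_eqF mr) addrC subrK.
Qed.

Lemma sum_coef_all : \sum_(i < r.+1) c i = k%:R.
Proof.
have cr : c r = q%:R ^+ r.
  by rewrite /c /block_coef; case: (r) r_gt0 => // s _; rewrite eqxx.
have := @sum_coef r.-1; rewrite prednK // => /(_ (leqnn r)) Sr.
rewrite big_ord_recr /= Sr cr /k /degree natrM natrD mulrDl natrX subn1 mul1r.
by rewrite addrC -exprS prednK.
Qed.

Lemma adj_sqr : M *m M = \sum_(d < r.+1) c d *: Em d.
Proof.
apply/matrixP => x y; rewrite mxE summxE.
under eq_bigr do rewrite !mxE -natrM mulnb.
under [RHS]eq_bigr do rewrite !mxE.
rewrite (sum_pred (fun z => adj x z && adj z y)).
have [Exy|nExy] := boolP (E 0 x y); last first.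
  rewrite eq_card0 => [|z]; last first.
    by rewrite inE; apply: contraNF nExy => /andP[]; apply: common0.
  rewrite big1 // => d _; case: (boolP (E d x y)) => [/(E_le (leq0n d))|].
    by rewrite (negPf nExy).
  by rewrite mulr0.
have [<-|xy] := eqVneq x y.
  under [RHS]eq_bigr do rewrite E_refl mulr1.
  rewrite sum_coef_all -(card_adj x); congr _%:R; apply: eq_card => z.
  by rewrite [LHS]inE adj_sym andbb.
(* The first level separating [x] from [y] is [d.+1], with [d] the finest level relating them; the
   coefficients up to [d] telescope to [q ^ d]. *)
have exN : exists m, ~~ E m x y by exists r; rewrite E_last.
case: (ex_minnP exN) => -[|d] nEd dmin; first by rewrite Exy in nEd.
have Ed : E d x y by apply/negPn/negP => /dmin; rewrite ltnn.
have dr : (d < r)%N by apply: dmin; rewrite E_last.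
rewrite (commond dr Ed nEd) natrX -(sum_coef dr).
rewrite (big_ord_widen r.+1 c) ?leqW // big_mkcond; apply: eq_bigr => i _.
have [id|di] := ltnP; first by rewrite (E_le _ Ed) ?mulr1.
rewrite [E i x y](_ : _ = false) ?mulr0 //; apply: contraNF nEd; exact: E_le.
Qed.

(** Summing downwards from [d = r], where the term is $q^r$, each new term $(q^d-q^{d-1})q^{2(r-d)}$
    cancels the previous sum and leaves $q^{2r-d}$. *)
Lemma sum_coef_size j : (j <= r)%N ->
  \sum_(j <= d < r.+1) c d * (nu d)%:R = (lam j)%:R.
Proof.
have H i : (i < r)%N -> \sum_(r - i <= d < r.+1) c d * (nu d)%:R = q%:R ^+ (r + i).
  elim: i => [|i IH] ir.
    rewrite subn0 addn0 big_nat1 /c /nu /block_coef /block_size.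
    by case: (r) r_gt0 => // s _; rewrite eqxx subnn muln0 mulr1.
  rewrite big_ltn; last by lia.
  have -> : (r - i.+1).+1 = (r - i)%N by lia.
  rewrite {}IH ?(ltnW ir) //.
  have [d [rE dr]] : exists d, (r - i.+1 = d.+1)%N /\ (d.+1 < r)%N.
    by exists (r - i.+2)%N; split; lia.
  rewrite rE /c /nu /= (ltn_eqF dr) natrX.
  have -> : (r + i.+1 = d.+1 + 2 * (r - d.+1))%N by lia.
  have -> : (r + i = d + 2 * (r - d.+1))%N by lia.
  by rewrite mulrBl -!exprD subrK.
case: j => [_|j jr]; last first.
  have -> : j.+1 = (r - (r - j.+1))%N by lia.
  rewrite H; last by lia.
  by rewrite /lam /= [in RHS]subKn // natrX; congr (_ ^+ _); lia.
(* The term [d = 0] does not follow the pattern, as [nu 0] counts all points; adding it produces the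
   square of the degree. *)
have := H r.-1; rewrite (_ : (r - r.-1 = 1)%N); last by lia.
rewrite [in X in _ -> X]big_ltn // prednK // => ->; last by lia.
rewrite /c /nu /lam /= /k /degree mul1r.
have [s ->] : exists s, r = s.+1 by exists r.-1; rewrite prednK.
rewrite /= subn1 /= -natrX -natrD; congr _%:R.
have -> : (s.+1 + s = s + s + 1)%N by lia.
rewrite mul2n -addnn !expnD expn1 -!mulnn; move: (q ^ s)%N => a; ring.
Qed.

(** Levels [d >= j] are absorbed by [Em j], and their contributions add up to [lam j]; levels
    [d < j] survive as multiples of [Em d]. *)
Lemma mulE_adj_sqr j : (j <= r)%N ->
  Em j *m (M *m M) = \sum_(d < j) (c d * (nu j)%:R) *: Em d + (lam j)%:R *: Em j.
Proof.
move=> jr; rewrite adj_sqr mulmx_sumr -sum_coef_size // scaler_suml.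
rewrite -(big_mkord xpredT (fun d => Em j *m (c d *: Em d))).
rewrite -(big_mkord xpredT (fun d => (c d * (nu j)%:R) *: Em d)).
rewrite (@big_cat_nat _ _ _ j) ?leqW //=; congr (_ + _); apply: eq_big_nat => d /andP[jd dj].
  by rewrite -scalemxAr mulEl 1?ltnW // scalerA.
by rewrite -scalemxAr mulEr // scalerA.
Qed.

Let pol j : {poly R} := \prod_(i < j) ('X^2 - (lam i)%:R%:P).

Lemma horner_sqr a : horner_mx M ('X^2 - a%:P) = M *m M - a%:M.
Proof. by rewrite rmorphB /= rmorphXn /= horner_mx_X horner_mx_C. Qed.

(** The last factor turns [Em j] into a combination of the [Em d] with [d < j], which the earlier
    factors annihilate by induction. *)
Lemma mulE_pol j i : (j <= r.+1)%N -> (i < j)%N -> Em i *m horner_mx M (pol j) = 0.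
Proof.
elim: j i => // j IH i jr; rewrite ltnS leq_eqVlt => /orP[/eqP ->{i}|ij].
  rewrite /pol big_ord_recr /= mulrC rmorphM /= horner_sqr mulmxA.
  rewrite mulmxBr mulE_adj_sqr // -scalemx1 -scalemxAr mulmx1 addrK.
  rewrite mulmx_suml big1 // => d _.
  by rewrite -scalemxAl IH ?scaler0 // ltnW.
by rewrite /pol big_ord_recr /= rmorphM /= mulmxA IH ?mul0mx // ltnW.
Qed.

Lemma pol_adj : horner_mx M (pol r.+1) = 0.
Proof.
have <- : Em r *m horner_mx M (pol r.+1) = horner_mx M (pol r.+1).
  rewrite (_ : Em r = 1%:M) ?mul1mx //; apply/matrixP => x y.
  by rewrite !mxE E_last.
exact: mulE_pol.
Qed.

Lemma eigenvalue_sqr a : eigenvalue M a -> exists2 j, (j <= r)%N & a ^+ 2 = (lam j)%:R.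
Proof.
rewrite eigenvalue_root_min -dvdp_XsubCl => /dvdp_trans/(_ (mxminpoly_min pol_adj)).
rewrite dvdp_XsubCl /root /pol horner_prod prodf_seq_eq0 => /hasP[j _ /=].
rewrite !hornerE subr_eq0 => /eqP aj; exists j => //; exact: ltn_ord j.
Qed.

(** Strictness makes every class of [E j.-1] contain two distinct classes of [E j], as needed to
    build eigenvectors. *)
Lemma block_size_lt j : (0 < j <= r)%N -> (nu j < nu j.-1)%N.
Proof.
case: j => [//|[|j]] /= jr; last by rewrite ltn_exp2l //; lia.
rewrite -[X in (X < _)%N]mul1n ltn_pmul2r ?expn_gt0 ?(ltnW q_gt1) //.
by rewrite addn1 ltnS addn_gt0 (ltnW q_gt1) orbT.
Qed.

Lemma block_eigenvalue_gt0 j : (0 < lam j)%N.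
Proof.
case: j => [|j]; rewrite /lam /= ?expn_gt0 ?(ltnW q_gt1) //.
by rewrite /k /degree addn1 muln_gt0 expn_gt0 (ltnW q_gt1).
Qed.

(* If [w] is the difference of the indicators of two classes of [E j] inside one
   class of [E j.-1] (or the indicator of a class of [E 0]), then
   [w M^2 = a^2 w], so [a w + w M] is an eigenvector for [a]; it is nonzero
   because [w] and [w M] live on opposite sides of the bipartition. *)
Lemma sqr_eigenvalue j a : (j <= r)%N -> a ^+ 2 = (lam j)%:R -> eigenvalue M a.
Proof.
move=> jr aj; have a0 : a != 0.
  by rewrite -sqrf_eq0 aj pnatr_eq0 -lt0n block_eigenvalue_gt0.
have [w [x [wM wx wE]]] : exists w : 'rV_n, exists x,
    [/\ w *m (M *m M) = a ^+ 2 *: w, w 0 x = 1 & forall z, adj z x -> w 0 z = 0].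
  rewrite aj; case: j {aj} jr => [|j] jr.
    exists (row 0 (Em 0)), 0; split.
    - by rewrite -row_mul mulE_adj_sqr // big_ord0 add0r linearZ.
    - by rewrite !mxE E_refl.
    - by move=> z /adj_E0 z0; rewrite !mxE E_sym (negPf z0).
  pose x0 : 'I_n := ord0.
  have : (#|E j.+1 x0| < #|E j x0|)%N by rewrite !card_E; apply: block_size_lt.
  rewrite ltnNge => /negP H.
  have /subsetPn[y] : ~~ (E j x0 \subset E j.+1 x0).
    by apply/negP => /subset_leq_card.
  rewrite -!topredE /= => y1 y2.
  exists (row x0 (Em j.+1) - row y (Em j.+1)), x0; split.
  - rewrite scalerBr mulmxBl -!row_mul mulE_adj_sqr // !linearD /= addrACA !linearZ /=.
    rewrite -[RHS]add0r; congr (_ + _).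
    rewrite !linear_sum -big_split big1 //= => d _; rewrite !linearZ /= -scalerDr.
    (* For [d <= j] the vertices [x0] and [y] lie in one class of [E d], so their rows in [Em d]
       agree and the lower terms cancel. *)
    rewrite [X in _ *: X](_ : _ = 0) ?scaler0 //; apply/rowP => z; rewrite !mxE.
    have dy : E d x0 y by apply: E_le y1; rewrite -ltnS.
    apply/eqP; rewrite subr_eq0; apply/eqP; congr (_%:R); congr nat_of_bool.
    apply/idP/idP; last exact: E_trans.
    by apply: E_trans; rewrite E_sym.
  - by rewrite !mxE E_refl E_sym (negPf y2) subr0.
  - move=> z /adj_E0 z0; rewrite !mxE.
    have /negPf-> : ~~ E j.+1 x0 z.
      by apply: contraNN z0; rewrite E_sym; apply: E_le.
    have /negPf-> : ~~ E j.+1 y z.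
      apply: contraNN z0 => yz; rewrite E_sym; apply: E_trans (E_le (leq0n j) y1) _.
      exact: E_le yz.
    by rewrite subrr.
apply/eigenvalueP; exists (a *: w + w *m M).
  rewrite mulmxDl -mulmxA wM -scalemxAl scalerDr scalerA addrC; congr (_ + _).
(* The entry at [x] equals [a], because [w] vanishes on the neighbours of [x]. *)
apply/eqP => /rowP/(_ x)/eqP; rewrite !mxE wx mulr1 big1 ?addr0 ?(negPf a0) // => z _.
by rewrite !mxE; case: (boolP (adj z x)) => [/wE->|_]; rewrite ?mul0r ?mulr0.
Qed.

(** Beyond the monotonicity of powers of $q$, the point is $(q+1)^2q^{2(r-1)}>q^{2r-1}$. *)
Lemma block_eigenvalue_lt i j : (i < j <= r)%N -> (lam j < lam i)%N.
Proof.
case: j => [|j]; first by rewrite ltn0.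
case: i => [|i] /andP[ij jr]; last by rewrite ltn_exp2l //; lia.
rewrite /lam /= /k /degree.
have [s rE] : exists s, r = s.+1 by exists r.-1; rewrite prednK.
apply: (@leq_ltn_trans (q ^ (s + s + 1))); first by rewrite leq_exp2l //; lia.
rewrite rE subn1 /= !expnD expn1 -mulnn.
have : (0 < q ^ s)%N by rewrite expn_gt0 (ltnW q_gt1).
by move: (q ^ s)%N q_gt1 => a ? ?; nia.
Qed.

Lemma block_eigenvalue_inj : {in [pred i | (i <= r)%N] &, injective lam}.
Proof.
move=> i j; rewrite !inE => ir jr ij; case: (ltngtP i j) => // lt.
  by have := @block_eigenvalue_lt i j; rewrite lt jr ij ltnn => /(_ isT).
by have := @block_eigenvalue_lt j i; rewrite lt ir ij ltnn => /(_ isT).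
Qed.

Lemma sqr_sqrt_nat m : Num.sqrt (m%:R : R) ^+ 2 = m%:R.
Proof. by rewrite sqr_sqrtr ?ler0n. Qed.

(** The [lam j] are positive and distinct, so the annihilating polynomial splits with simple roots
    $\pm\sqrt{\lambda_j}$. *)
Lemma adj_diagonalizable : diagonalizable M.
Proof.
apply/diagonalizableP; pose f i : R := Num.sqrt (lam i)%:R.
exists (map f (index_iota 0 r.+1) ++ map (fun i => - f i) (index_iota 0 r.+1)).
  have fI : {in index_iota 0 r.+1 &, injective f}.
    move=> i j; rewrite !mem_index_iota !ltnS /= => ir jr.
    move=> /(congr1 (fun x => x ^+ 2)); rewrite /f !sqr_sqrt_nat => /eqP.
    by rewrite eqr_nat => /eqP; apply: block_eigenvalue_inj.
  have f0 i : 0 < f i by rewrite sqrtr_gt0 ltr0n block_eigenvalue_gt0.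
  rewrite cat_uniq !map_inj_in_uniq ?iota_uniq //; last first.
    by move=> i j ii jj /oppr_inj; apply: fI.
  rewrite andbT andTb; apply/hasPn => _ /mapP[i _ ->]; apply/mapP => -[j _ fE].
  by have := f0 j; rewrite -fE oppr_gt0 ltNge ltW.
have := @big_mkord {poly R} 1 *%R r.+1 xpredT; move: (index_iota 0 r.+1) => s sE.
rewrite big_cat !big_map /= -big_split /= sE.
apply: mxminpoly_min; rewrite -[RHS]pol_adj; congr horner_mx; apply: eq_bigr => i _.
by rewrite polyCN opprK -subr_sqr -polyC_exp sqr_sqrt_nat.
Qed.

(* Maximum principle: the set where [v] is maximal is closed under adjacency. *)
Lemma top_eigenvector (v : 'rV_n) : v *m M = k%:R *: v -> exists a, v = const_mx a.
Proof.
move=> vM; have [i0 _ imax] := @Order.TotalTheory.arg_maxP _ _ _ 0 xpredT (v 0) isT.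
exists (v 0 i0); apply/rowP => j; rewrite mxE; apply/eqP.
apply: (adj_connected (S := fun i => v 0 i == v 0 i0) (eqxx _)) => x z /eqP vx xz.
have := vM => /rowP/(_ x); rewrite !mxE vx.
under eq_bigr do rewrite mxE.
rewrite -(card_adj x) -(sum_pred (adj x)) mulr_suml => /esym/eqP.
rewrite -subr_eq0 -sumrB => /eqP/psumr_eq0P S0.
have := S0 _ z isT; rewrite xz adj_sym xz mulr1 mul1r => /(_ _)/eqP.
rewrite subr_eq0 eq_sym; apply => y _.
rewrite [adj y x]adj_sym mulrC -mulrBl; apply: mulr_ge0; last exact: ler0n.
by rewrite subr_ge0; apply: imax.
Qed.

Lemma head_sorted_max (s : seq R) b x0 : sorted >=%R s -> b \in s ->
  (forall x, x \in s -> x <= b) -> nth x0 s 0 = b.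
Proof.
case: s => //= x s xs; rewrite inE => /orP[/eqP->//|bs] smax.
apply/le_anti; rewrite smax ?mem_head //=.
by have /allP/(_ _ bs) := order_path_min (rev_trans le_trans) xs.
Qed.

(** Diagonalization lists the eigenvalues with multiplicity. One occurrence of the degree is
    removed, simplicity shows that no other is left, and the rest is sorted; its maximum is then
    $\sqrt{\lambda_1}$. *)
Lemma sorted_spectrum : exists s : seq R,
  [/\ sorted >=%R s, char_poly M = \prod_(x <- s) ('X - x%:P), (1 < size s)%N &
     s`_1 = Num.sqrt (lam 1)%:R].
Proof.
have [P Pu /diagonalizable_forPex[D /(simmxP Pu) PM]] := adj_diagonalizable.
have chiE : char_poly M = \prod_(i < n) ('X - (D 0 i)%:P).
  rewrite (char_poly_sim Pu PM) char_poly_trig ?diag_mx_is_trig //.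
  by apply: eq_bigr => i _; rewrite mxE eqxx mulr1n.
have eigD i : eigenvalue M (D 0 i).
  rewrite eigenvalue_root_char chiE /root horner_prod prodf_seq_eq0; apply/hasP.
  by exists i; rewrite ?mem_index_enum // !hornerE subrr.
have exD a : eigenvalue M a -> exists i, D 0 i = a.
  rewrite eigenvalue_root_char chiE /root horner_prod prodf_seq_eq0 => /hasP[i _].
  by rewrite /= !hornerE subr_eq0 => /eqP ->; exists i.
have kE : k%:R ^+ 2 = (lam 0)%:R :> R by rewrite natrX.
have [i0 Di0] := exD _ (sqr_eigenvalue (leq0n r) kE).
(* Two indices with eigenvalue [k] would give two constant, hence dependent, rows of the invertible
   matrix [P]. *)
have top_uniq j : D 0 j = k%:R -> j = i0.
  move=> Dj; have rowM i : D 0 i = k%:R -> exists a, row i P = const_mx a.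
    move=> Di; apply: top_eigenvector; rewrite -row_mul PM -Di.
    by apply/rowP => z; rewrite !mxE (bigD1 i) //= big1 ?addr0 ?mxE ?eqxx //
      => y yi; rewrite mxE eq_sym (negPf yi) mul0r.
  have [[a aE] [b bE]] := (rowM _ Di0, rowM _ Dj).
  apply/eqP/negPn/negP => ji.
  have : (b *: delta_mx 0 i0 - a *: delta_mx 0 j : 'rV_n) *m P = 0.
    rewrite mulmxBl -!scalemxAl -!rowE aE bE; apply/rowP => z.
    by rewrite !mxE mulrC subrr.
  move/(congr1 (mulmx^~ (invmx P))); rewrite mulmxK // mul0mx => /rowP/(_ j)/eqP.
  rewrite !mxE !eqxx (negPf ji) /= mulr0 mulr1 sub0r oppr_eq0 => /eqP a0.
  have : (delta_mx 0 i0 : 'rV_n) *m P = 0 by rewrite -rowE aE a0.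
  move/(congr1 (mulmx^~ (invmx P))); rewrite mulmxK // mul0mx => /rowP/(_ i0)/eqP.
  by rewrite !mxE !eqxx oner_eq0.
pose t := [seq D 0 i | i <- rem i0 (index_enum 'I_n)].
have tP x : x \in t -> x != k%:R /\ eigenvalue M x.
  move=> /mapP[i ii ->]; split=> //; apply: contraTneq ii => /top_uniq ->.
  by rewrite mem_rem_uniq ?index_enum_uniq // inE eqxx.
have max x : eigenvalue M x -> x != k%:R -> x <= Num.sqrt (lam 1)%:R.
  move=> /eigenvalue_sqr[[|j] jr xj] xk.
    (* Here [x = - k%:R], which lies below every square root. *)
    have /eqP : x ^+ 2 = k%:R ^+ 2 by rewrite xj kE.
    rewrite eqf_sqr (negPf xk) => /eqP ->.
    by rewrite (le_trans _ (sqrtr_ge0 _)) // oppr_le0.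
  rewrite (le_trans (ler_norm _)) // -sqrtr_sqr xj ler_sqrt ?ler0n // ler_nat.
  case: j jr {xj} => // j jr; apply: ltnW; exact: block_eigenvalue_lt.
have mt : Num.sqrt (lam 1)%:R \in t.
  have [i Di] := exD _ (sqr_eigenvalue r_gt0 (sqr_sqrt_nat (lam 1))).
  rewrite -Di map_f // mem_rem_uniq ?index_enum_uniq // inE mem_index_enum andbT.
  apply/eqP => ii; have := @block_eigenvalue_lt 0 1 r_gt0.
  move: (Di0); rewrite -ii Di => /(congr1 (fun x => x ^+ 2)).
  by rewrite sqr_sqrt_nat kE => /eqP; rewrite eqr_nat => /eqP ->; rewrite ltnn.
exists (k%:R :: sort >=%R t); split.
- rewrite /= path_min_sorted; first by apply: sort_sorted => x y; apply: le_total.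
  apply/allP => x; rewrite mem_sort => /tP[xk /max/(_ xk) xle] /=.
  rewrite (le_trans xle) // -[leRHS]ger0_norm ?ler0n // -sqrtr_sqr kE.
  by rewrite ler_sqrt ?ler0n // ler_nat ltnW //; apply: block_eigenvalue_lt.
- rewrite chiE big_cons (perm_big t) /=; last by rewrite perm_sort.
  by rewrite (perm_big _ (perm_to_rem (mem_index_enum i0))) big_cons Di0 big_map.
- by rewrite /= size_sort ltnS; case: (t) mt.
- rewrite /=; apply: head_sorted_max; rewrite ?mem_sort //.
    by apply: sort_sorted => x y; apply: le_total.
  by move=> x; rewrite mem_sort => /tP[xk /max]; apply.
Qed.

End BlockSpectrum.

From mathcomp Require Import ring_quotient.
From mathcomp Require Import boolp classical_sets functions cardinality reals.

Local Open Scope classical_set_scope.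
Local Open Scope card_scope.
Local Open Scope ring_scope.

(** * Finite ring structures obtained from enumerations *)

Lemma enum_index_cancel (T : nmodType) (s : seq T) :
  (forall x, x \in s) -> cancel (index^~ s) (nth 0 s).
Proof. by move=> sT x; apply: nth_index. Qed.

Lemma enum_undup_axiom (T : eqType) (s : seq T) :
  (forall x, x \in s) -> Finite.axiom (undup s).
Proof. by move=> sT x; rewrite count_uniq_mem ?undup_uniq // mem_undup sT. Qed.

(** The ring class of [A] is reused as it stands, so that forgetting finiteness gives back [A]
    itself and not only an isomorphic ring. *)
Definition enum_ring (A : comNzRingType) (s : seq A) (sA : forall x, x \in s) :
    finComNzRingType :=
  HB.pack_for finComNzRingType (GRing.ComNzRing.sort A) (GRing.ComNzRing.class A)
    (CanIsCountable (enum_index_cancel sA)) (isFinite.Build _ (enum_undup_axiom sA)).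

Lemma enum_ringE (A : comNzRingType) (s : seq A) (sA : forall x, x \in s) :
  enum_ring sA = A :> comNzRingType.
Proof.
(* Without eta for records, both sides only reduce once [A] is a constructor. *)
by case: A s sA => T [].
Qed.

(** * The quotient $\mathcal O/\pi^r$ is a chain ring *)

Section IntegersMod.
Variables (F : fieldType) (v : discreteValuation F) (p : integers v).
Hypothesis hp : uniformizer p.
Notation O := (integers v).
Local Notation iv := (@integers_val F v).

Let p0 : iv p != 0. Proof. by case: hp. Qed.

Lemma integers_valM (x y : O) : iv (x * y) = iv x * iv y.
Proof. exact: (rmorphM (val : O -> F)). Qed.

Lemma uniformizer_dvd (x : O) : x \in maximal_ideal v -> exists y, x = p * y.
Proof.
rewrite unfold_in /maximal_ideal => xm.
have [p_neq0 vp] := hp.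
have yO : iv x / iv p \in valuation_ring v.
  move: xm; rewrite !unfold_in /valuation_ring /val_ge.
  have [->|x0] := eqVneq (iv x) 0; first by rewrite mul0r eqxx.
  rewrite mulf_eq0 invr_eq0 (negPf x0) (negPf p_neq0) /= => v1.
  suff -> : v (iv x / iv p) = v (iv x) - 1 by rewrite subr_ge0.
  have xp0 : iv x / iv p != 0 by rewrite mulf_neq0 ?invr_neq0.
  by have := dvalM v xp0 p_neq0; rewrite divfK // vp => ->; rewrite addrK.
exists (Integers yO); apply: val_inj; apply/esym/(etrans (integers_valM _ _)).
by rewrite /= mulrC divfK.
Qed.

Lemma uniformizer_maximal (y : O) : p * y \in maximal_ideal v.
Proof.
have pm : p \in maximal_ideal v by rewrite !unfold_in hp.2 lexx orbT.
by rewrite mulrC idealMr.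
Qed.

(** An integer outside the maximal ideal has valuation [0], hence an integral inverse. *)
Lemma integers_local (x : O) : (exists y, x = p * y) \/ (exists y, x * y = 1).
Proof.
have [/uniformizer_dvd|xm] := boolP (x \in maximal_ideal v); [by left|right].
have /andP[x0 vx] : (iv x != 0) && (v (iv x) == 0).
  move: xm (valP x); rewrite !unfold_in.
  case: eqVneq => //= x0; rewrite -ltNge => v1 v0; rewrite eq_le v0 andbT.
  by rewrite -(@ltzD1 _ 0) add0r.
have yO : (iv x)^-1 \in valuation_ring v.
  rewrite !unfold_in /valuation_ring /val_ge; apply/orP; right.
  have := dvalM v x0 (invr_neq0 x0); rewrite divff // dval1 (eqP vx) add0r => <-.
  by [].
exists (Integers yO); apply: val_inj; apply/(etrans (integers_valM _ _)).
exact: divff.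
Qed.

(** Equalities in the two quotients are pulled back to divisibility in $\mathcal O$, by [p ^+ r] for
    [fE] and by [p] for [gE]. *)
Lemma integers_mod_chain (q : nat) (hq : ([set: residue_field v] #= `I_q)%card)
    (r : nat) (hr : (0 < r)%N) :
  chain_ring (\pi_(integers_mod hp hr) p)%qT q r.
Proof.
pose J := principal_ideal (uniformizer_exp_nonunit hp hr).
pose f : {rmorphism O -> integers_mod hp hr} := (\pi_({ideal_quot J}))%qT.
have fE x y : f x = f y <-> exists z, x - y = p ^+ r * z.
  split=> [/eqP|xy].
    by rewrite -[_ == _](Quotient.idealrBE J) => /asboolP.
  by apply/eqP; rewrite -[_ == _](Quotient.idealrBE J); apply/asboolP.
have f_surj a : exists x, a = f x by exists (repr a); rewrite /f /= reprK.
pose g : O -> residue_field v := (\pi_({ideal_quot maximal_ideal v}))%qT.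
have gE x y : g x = g y <-> exists z, x - y = p * z.
  split=> [/eqP|[z xy]].
    by rewrite -[_ == _](Quotient.idealrBE (maximal_ideal v)) => /uniformizer_dvd.
  apply/eqP; rewrite -[_ == _](Quotient.idealrBE (maximal_ideal v)) xy.
  exact: uniformizer_maximal.
split=> //.
- by rewrite -[LHS](rmorphXn f) -(rmorph0 f); apply/fE; exists 1; rewrite subr0 mulr1.
- apply/eqP; rewrite -[LHS](rmorphXn f) -(rmorph0 f) => /fE[z]; rewrite subr0 => pz.
  (* If [p ^+ r.-1 = p ^+ r * z], cancelling in the field gives [1 = p * z], which would put [1] in
     the maximal ideal. *)
  have : iv p ^+ r.-1 * iv (1 - p * z) = 0.
    rewrite -(rmorphXn (val : O -> F)) -integers_valM mulrBr mulr1 mulrA -exprSr.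
    by rewrite prednK // -pz subrr.
  move/eqP; rewrite mulf_eq0 expf_eq0 (negPf p0) andbF /= => /eqP pz1.
  have : 1 - p * z = 0 by apply: val_inj.
  move/eqP; rewrite subr_eq0 => /eqP pz'.
  by have := uniformizer_maximal z; rewrite -pz' idealr1.
- move=> a; have [x ->] := f_surj a.
  have [[y ->]|[y xy]] := integers_local x; [left|right]; exists (f y).
    by rewrite rmorphM.
  by rewrite -rmorphM xy rmorph1.
have /card_set_bijP[h [hF hI hS]] := hq.
(* The digits are lifts to $\mathcal O$ of the [q] residue classes. *)
have /choice[t tP] : forall i : 'I_q, exists x, h (g x) = i.
  move=> i; have [a _ <-] := hS i (ltn_ord i).
  by exists (repr a); congr h; rewrite /g reprK.
exists (f \o t); split=> [a|i j b].
  have [x ->] := f_surj a; have lt : (h (g x) < q)%N.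
    exact: hF (g x) I.
  exists (Ordinal lt).
  have /gE[y xy] : g x = g (t (Ordinal lt)) by apply: hI; rewrite ?inE // tP.
  by exists (f y); rewrite /= -rmorphM -rmorphD -xy addrC subrK.
have [y ->] := f_surj b; rewrite /= -rmorphM -rmorphD => /fE[z tij].
apply: ord_inj; rewrite -!tP; congr h; apply/gE.
exists (y + p ^+ r.-1 * z); rewrite mulrDr mulrA -exprS prednK // -tij; ring.
Qed.
End IntegersMod.

(** * Free submodules of $A^3$ as spans and kernels *)

Section Plane.
Variables (A : finComNzRingType) (p : A) (q r : nat).
Hypothesis Achain : chain_ring p q r.

Local Notation V := 'rV[A]_3.
Local Notation unimodular := (unimodular p).
Local Notation normalized := (normalized p).
Local Notation aunit := (aunit p).

Let q_gt1 : (1 < q)%N := q_gt1 Achain.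

Definition span (x : V) : pred V := fun y => [exists a, y == a *: x].
Definition orth (f : V) : pred V := fun y => dot f y == 0.

Lemma spanP x y : reflect (exists a, y = a *: x) (span x y).
Proof. exact: exists_eqP. Qed.

Lemma card_V m : #|{: 'rV[A]_m}| = (q ^ (r * m))%N.
Proof. by rewrite card_mx mul1n (card_chain Achain) -expnM. Qed.

Lemma unimodular_scaleI x : unimodular x -> injective (fun a : A => a *: x).
Proof.
move=> /unimodularP[i xi] a b /rowP/(_ i).
by rewrite !mxE ![_ * x 0 i]mulrC; apply: (aunit_mulI Achain).
Qed.

Lemma card_span x : unimodular x -> #|span x| = (q ^ r)%N.
Proof.
move=> ux; rewrite -(card_chain Achain) -(fintype.card_image (unimodular_scaleI ux)).
apply: eq_card => y; apply/spanP/fintype.imageP => [[a ->]|[a _ ->]]; by exists a.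
Qed.

Lemma card_orth f : unimodular f -> #|orth f| = (q ^ (2 * r))%N.
Proof.
move=> uf; rewrite -[r in RHS]subn0 -(card_dot1 Achain 0 uf).
apply: eq_card => y; rewrite inE andb_idl // => _.
by apply/forallP => i; apply: pdvd0x.
Qed.

Lemma is_submodule_linear m (f : {linear 'rV[A]_m -> V}) : is_submodule (range f).
Proof.
split; first by rewrite inE; exists 0 => //; rewrite linear0.
move=> a x y; rewrite !inE => -[u _ <-] [w _ <-].
by exists (a *: u + w) => //; rewrite linearP.
Qed.

(** Positive rank makes the image nonzero; rank below [3] makes it too small to be $A^3$. *)
Lemma linear_vertex m (f : {linear 'rV[A]_m -> V}) (B : pred V) :
  (0 < m < 3)%N -> injective f -> range f = [set` B] ->
  free_flag_vertices A [set` B].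
Proof.
move=> /andP[m0 m3] fI fB; split.
- by rewrite -fB; apply: is_submodule_linear.
- by exists m, f.
- rewrite -fB => f0; pose e : 'rV[A]_m := const_mx 1.
  have : range f (f e) by exists e.
  rewrite f0 /= -(linear0 f) => /fI/rowP/(_ (Ordinal m0)).
  by rewrite !mxE => /eqP; rewrite oner_eq0.
- rewrite -fB => fT.
  have : (#|{: V}| <= #|[set: 'rV[A]_m]%SET|)%N.
    apply: leq_trans (leq_imset_card f _); apply: subset_leq_card.
    apply/fintype.subsetP => y _; have : range f y by rewrite fT.
    by move=> [x _ <-]; apply: imset_f.
  rewrite cardsT !card_V leq_exp2l // leq_pmul2l ?(chain_gt0 Achain) //.
  by rewrite leqNgt m3.
Qed.

Lemma span_vertex x : unimodular x -> free_flag_vertices A [set` span x].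
Proof.
move=> ux; have xE (a : 'rV[A]_1) : a *m x = a 0 0 *: x.
  by rewrite {1}[a]mx11_scalar mul_scalar_mx.
apply: (@linear_vertex 1 (mulmxr x)) => //=.
- move=> a b /=; rewrite !xE => /(unimodular_scaleI ux) ab.
  by apply/rowP => i; rewrite !ord1.
- apply/seteqP; split=> y /=; first by move=> [a _ <-]; apply/spanP; exists (a 0 0).
  by move=> /spanP[a ->]; exists a%:M; rewrite //= xE mxE eqxx mulr1n.
Qed.

(** With [f 0 i] invertible, the vectors $e_j-(f_j/f_i)e_i$ for the two indices $j\ne i$ form a
    basis: they are independent by their coordinates away from [i], and span because the kernel also
    has $q^{2r}$ elements. *)
Lemma orth_vertex f : unimodular f -> free_flag_vertices A [set` orth f].
Proof.
move=> uf; have /unimodularP[i fi] := uf; have [u fu] := aunitP Achain _ fi.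
pose b (j : 'I_2) : V := delta_mx 0 (lift i j) - (u * f 0 (lift i j)) *: delta_mx 0 i.
pose B : 'M[A]_(2, 3) := \matrix_j b j.
have BE (a : 'rV[A]_2) : a *m B = \sum_j a 0 j *: b j.
  by rewrite mulmx_sum_row; apply: eq_bigr => j _; rewrite rowK.
have fB a : orth f (a *m B).
  rewrite /orth BE; elim/big_ind: _ => [|x y /eqP fx /eqP fy|j _].
  - by rewrite -(scale0r 0) dotZr mul0r.
  - by rewrite dotDr fx fy addr0.
  - rewrite dotZr dotBr dotZr !dot_delta mulrAC [u * _]mulrC fu mul1r subrr.
    by rewrite mulr0.
have BI : injective (mulmxr B : 'rV[A]_2 -> V).
  move=> a a' /= /rowP aa'; apply/rowP => j.
  have bE c : (c *m B) 0 (lift i j) = c 0 j.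
    rewrite mxE (bigD1 j) //= big1 => [|j' jj']; rewrite !mxE ?eqxx /=.
      by rewrite eq_sym (negPf (neq_lift _ _)) mulr0 subr0 mulr1 addr0.
    rewrite (inj_eq lift_inj) eq_sym (negPf jj') [lift i j == i]eq_sym.
    by rewrite (negPf (neq_lift _ _)) mulr0 subr0 mulr0.
  by rewrite -!bE aa'.
apply: (@linear_vertex 2 (mulmxr B)) => //=.
apply/seteqP; split=> y /=; first by move=> [a _ <-]; apply: fB.
have : [set mulmxr B a | a in [set: 'rV[A]_2]%SET]%SET == [set y | orth f y]%SET.
  rewrite eqEcard; apply/andP; split.
    by apply/fintype.subsetP => _ /imsetP[a _ ->]; rewrite finset.inE; apply: fB.
  by rewrite card_imset // cardsT cardsE card_V card_orth // mulnC.
move=> /eqP/setP/(_ y); rewrite [RHS]finset.inE => yE fy.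
by have /imsetP[a _ ->] := etrans yE fy; exists a.
Qed.

Lemma expp_scale_vdvd1 x : vdvd p 1 x -> p ^+ r.-1 *: x = 0.
Proof.
move=> /vdvdP[y ->]; rewrite scalerA -exprD addn1 prednK ?(chain_gt0 Achain) //.
by rewrite (chain_nil Achain) scale0r.
Qed.

(* Otherwise [p^(r-1)] would annihilate the image of a basis vector. *)
Lemma linear_unimodular m (f : {linear 'rV[A]_m -> V}) i :
  injective f -> unimodular (f (delta_mx 0 i)).
Proof.
move=> fI; apply/negP => /expp_scale_vdvd1; rewrite -linearZ -(linear0 f) => /fI.
move=> /rowP/(_ i); rewrite !mxE !eqxx mulr1 => /eqP.
by rewrite (negPf (chain_neq0 Achain)).
Qed.

(** Let [x 0 i] be a unit. If no minor at [i], [l] were one, then [p ^+ r.-1] would kill the image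
    of $x_ie_1-y_ie_0$, and injectivity would give [p ^+ r.-1 * x 0 i = 0]. *)
Lemma linear_minor (f : {linear 'rV[A]_2 -> V}) : injective f ->
  exists i l, aunit (minor (f (delta_mx 0 0)) (f (delta_mx 0 1)) i l).
Proof.
move=> fI; set x := f _; set y := f _.
have /unimodularP[i xi] := linear_unimodular 0 fI.
exists i; apply: contrapT => noun.
have : f (p ^+ r.-1 *: (x 0 i *: delta_mx 0 1 - y 0 i *: delta_mx 0 0)) = f 0.
  rewrite linear0 linearZ linearB !linearZ /= -/x -/y; apply: expp_scale_vdvd1.
  apply/forallP => l; rewrite !mxE [X in pdvd _ _ X](_ : _ = minor x y i l).
    by rewrite -[pdvd _ _ _]negbK; apply/negP => un; apply: noun; exists l.
  by rewrite /minor; ring.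
move=> /fI/rowP/(_ 1); rewrite !mxE /= mulr0 subr0 mulr1 => /eqP.
rewrite mulrC -[_ == _]negbK; case/negP.
apply: contraNneq (chain_neq0 Achain) => xp.
by apply/eqP/(aunit_mulI Achain xi); rewrite mulr0.
Qed.

Lemma third_index (i l : 'I_3) : exists k, (k != i) && (k != l).
Proof.
have := cardC (pred2 i l); rewrite card2 card_ord => E.
have /card_gt0P[k] : (0 < #|[predC pred2 i l]|)%N.
  by rewrite lt0n; apply/eqP => E0; move: E; rewrite E0; case: (i != l).
by rewrite !inE negb_or; exists k.
Qed.

(* A cross product, written around the invertible minor. *)
Lemma minor_orth x y i l : aunit (minor x y i l) ->
  exists w, [/\ unimodular w, dot w x = 0 & dot w y = 0].
Proof.
move=> u; have [k /andP[ki kl]] := third_index i l.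
exists (minor x y i l *: delta_mx 0 k + minor x y l k *: delta_mx 0 i +
        minor x y k i *: delta_mx 0 l); split.
- apply/unimodularP; exists k.
  by rewrite !mxE !eqxx (negPf ki) (negPf kl) /= !mulr0 mulr1 !addr0.
- by rewrite dotC !dotDr !dotZr !dot_delta /minor; ring.
- by rewrite dotC !dotDr !dotZr !dot_delta /minor; ring.
Qed.

Lemma span_scale u x : aunit u -> span (u *: x) =1 span x.
Proof.
move=> /(aunitP Achain)[w uw] y; apply/spanP/spanP => -[a ->].
  by exists (a * u); rewrite scalerA.
by exists (a * w); rewrite scalerA -mulrA [w * u]mulrC uw mulr1.
Qed.

Lemma orth_scale u x : aunit u -> orth (u *: x) =1 orth x.
Proof.
move=> /(aunit_mulI Achain) uI y; rewrite /orth dotZl -[RHS](inj_eq uI).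
by rewrite mulr0.
Qed.

(** Cardinality bounds the rank by [3]. Ranks [0] and [3] give the excluded submodules and rank [1]
    a span; in rank [2] the cross product of a basis gives a functional whose kernel has the same
    size as the image. *)
Lemma vertexP M : free_flag_vertices A M ->
  exists2 x, normalized x & M = [set` span x] \/ M = [set` orth x].
Proof.
move=> [_ [m [f [fI <-]]]].
have q0 := q_gt1; have r0 := chain_gt0 Achain.
have : (m <= 3)%N.
  by have := leq_card f fI; rewrite !card_V leq_exp2l // leq_pmul2l.
case: m f fI => [|[|[|[|//]]]] f fI _ f0 fT.
- case: f0; apply/seteqP; split=> [_ [a _ <-]|_ ->] /=; last by exists 0; rewrite ?linear0.
  by rewrite (_ : a = 0) ?linear0 //; apply/rowP => -[].
- have [u [x [uu nx fE]]] := normalize Achain (linear_unimodular 0 fI).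
  exists x => //; left; have fa a : f a = a 0 0 *: f (delta_mx 0 0).
    rewrite -linearZ; congr (f _); apply/rowP => i.
    by rewrite !mxE ord1 !eqxx mulr1.
  apply/seteqP; split=> [_ [a _ <-]|y /=].
    by rewrite /= -topredE /= -(span_scale x uu) -fE; apply/spanP; exists (a 0 0).
  rewrite -topredE /= -(span_scale x uu) -fE => /spanP[a ->].
  by exists (a *: delta_mx 0 0); rewrite ?linearZ.
- have [i [l mu]] := linear_minor fI; have [w [uw wx wy]] := minor_orth mu.
  have [u [z [uu nz wE]]] := normalize Achain uw.
  exists z => //; right; have fw a : orth w (f a).
    have -> : a = a 0 0 *: delta_mx 0 0 + a 0 1 *: delta_mx 0 1.
      apply/rowP => j; rewrite !mxE.
      by case: j => -[|[|//]] j2 /=; rewrite ?mulr1 ?mulr0 ?addr0 ?add0r;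
        congr (a _ _); apply: val_inj.
    by rewrite /orth linearD !linearZ /= dotDr !dotZr wx wy !mulr0 addr0.
  apply/seteqP; split=> [_ [a _ <-]|y /=].
    by rewrite /= -topredE /= -(orth_scale z uu) -wE; apply: fw.
  rewrite -topredE /= -(orth_scale z uu) -wE => wfy.
  have : [set f a | a in [set: 'rV[A]_2]%SET]%SET == [set y | orth w y]%SET.
    rewrite eqEcard; apply/andP; split.
      by apply/fintype.subsetP => _ /imsetP[a _ ->]; rewrite finset.inE; apply: fw.
    by rewrite card_imset // cardsT cardsE card_V card_orth // mulnC.
  move=> /eqP/setP/(_ y); rewrite [RHS]finset.inE => yE.
  by have /imsetP[a _ ->] := etrans yE wfy; exists a.
- case: fT; apply/seteqP; split=> // y _.
  have [g _ gK] := inj_card_bij fI (leqnn _).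
  by exists (g y); rewrite ?gK.
Qed.

Lemma span_sub_orth x f : {subset span x <= orth f} <-> dot f x = 0.
Proof.
split=> [xf|fx y /spanP[a ->]].
  by have /eqP := xf x (introT (spanP _ _) (ex_intro _ 1 (esym (scale1r x)))).
by rewrite -topredE /= /orth dotZr fx mulr0.
Qed.

Lemma span_subset x y : normalized x -> normalized y ->
  {subset span x <= span y} -> x = y.
Proof.
move=> nx ny xy; have /spanP[a xE] : x \in span y.
  by apply: xy; apply/spanP; exists 1; rewrite scale1r.
have ua : aunit a.
  apply/negP => /pdvdP[b aE]; have /negP := normalized_unimodular Achain nx; case.
  by apply/vdvdP; exists (b *: y); rewrite xE aE scalerA.
by have [_ ->] := normalized_scale Achain (aunit1 Achain) ua nx ny (etrans (scale1r x) xE).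
Qed.

(** With [i] the leading position of [f], each $e_j-f_je_i$ lies in the kernel of [f]; evaluating
    [g] on it gives $g_j=g_if_j$, so [g] is a multiple of [f]. *)
Lemma orth_subset f g : normalized f -> normalized g ->
  {subset orth f <= orth g} -> f = g.
Proof.
move=> nf ng fg; have /existsP[i /normal_atP[fi _]] := nf.
have gE : g = g 0 i *: f.
  apply/rowP => j; rewrite mxE.
  have /fg : delta_mx 0 j - f 0 j *: delta_mx 0 i \in orth f.
    by rewrite -topredE /= /orth dotBr dotZr !dot_delta fi mulr1 subrr.
  rewrite -topredE /= /orth dotBr dotZr !dot_delta subr_eq0 => /eqP ->.
  by rewrite mulrC.
have ug : aunit (g 0 i).
  apply/negP => /pdvdP[b aE]; have /negP := normalized_unimodular Achain ng; case.
  by apply/vdvdP; exists (b *: f); rewrite {1}gE aE scalerA.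
by have [_ ->] := normalized_scale Achain (aunit1 Achain) ug ng nf (etrans (scale1r g) gE).
Qed.

Lemma orth_not_sub_span f x : unimodular f -> unimodular x ->
  ~ {subset orth f <= span x}.
Proof.
move=> uf ux /fintype.subsetP/subset_leq_card.
rewrite card_orth // card_span // leq_exp2l // -{2}[r]mul1n leq_pmul2r //.
exact: chain_gt0 Achain.
Qed.

(** * The incidence model: [inl] for spans, [inr] for kernels *)

Local Notation point := {x : V | normalized x}.

Local Notation pvertex := (point + point)%type.

Definition padj : rel pvertex := fun z w =>
  match z, w with
  | inl x, inr f | inr f, inl x => dot (val f) (val x) == 0
  | _, _ => false
  end.

Definition pblock d : rel pvertex := fun z w =>
  match z, w with
  | inl x, inl y | inr x, inr y => congr_at p d (val x) (val y)
  | _, _ => false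
  end.

Lemma point_unimodular (x : point) : unimodular (val x).
Proof. by apply: (normalized_unimodular Achain); apply: valP. Qed.

Definition vertex_of (z : pvertex) : free_projective_plane A :=
  match z with
  | inl x => SigSub (mem_set (span_vertex (point_unimodular x)))
  | inr f => SigSub (mem_set (orth_vertex (point_unimodular f)))
  end.

Lemma sub_set_of (P Q : pred V) : [set` P] `<=` [set` Q] <-> {subset P <= Q}.
Proof. by []. Qed.

Lemma vertex_of_inj : injective vertex_of.
Proof.
move=> [x|f] [y|g] /(congr1 val) /= /seteqP[/sub_set_of s1 /sub_set_of s2].
- by congr inl; apply: val_inj; apply: span_subset (valP x) (valP y) s1.
- by case: (orth_not_sub_span (point_unimodular _) (point_unimodular _) s2).
- by case: (orth_not_sub_span (point_unimodular _) (point_unimodular _) s1).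
- by congr inr; apply: val_inj; apply: orth_subset (valP f) (valP g) s1.
Qed.

Lemma vertex_of_surj (M : free_projective_plane A) : exists z, vertex_of z = M.
Proof.
have [x nx ME] := vertexP (set_mem (valP M)).
by case: ME => ME; [exists (inl (exist _ x nx))|exists (inr (exist _ x nx))];
  apply: val_inj; rewrite /= ME.
Qed.

(** Inclusion between two spans or two kernels forces equality, and a kernel is too large to lie in
    a span; what remains is a span inside a kernel. *)
Lemma vertex_of_adj z w : adj (vertex_of z) (vertex_of w) <-> padj z w.
Proof.
case: z w => [x|f] [y|g]; split=> //.
- case=> neq [] /sub_set_of s; case: neq; congr vertex_of; congr inl; apply: val_inj.
    exact: span_subset (valP x) (valP y) s.
  exact/esym/(span_subset (valP y) (valP x) s).
- case=> neq [] /sub_set_of s; first by apply/eqP/span_sub_orth.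
  by case: (orth_not_sub_span (point_unimodular _) (point_unimodular _) s).
- move=> xg; split; first by move=> /(@vertex_of_inj (inl x) (inr g)).
  by left; apply/sub_set_of/span_sub_orth/eqP.
- case=> neq [] /sub_set_of s; last by apply/eqP/span_sub_orth.
  by case: (orth_not_sub_span (point_unimodular _) (point_unimodular _) s).
- move=> xg; split; first by move=> /(@vertex_of_inj (inr f) (inl y)).
  by right; apply/sub_set_of/span_sub_orth/eqP.
- case=> neq [] /sub_set_of s; case: neq; congr vertex_of; congr inr; apply: val_inj.
    exact: orth_subset (valP f) (valP g) s.
  exact/esym/(orth_subset (valP g) (valP f) s).
Qed.

Lemma card_inl (Q : pred point) :
  #|[pred w : pvertex | if w is inl y then Q y else false]| = #|Q|.
Proof.
have inl_inj : injective (inl : point -> pvertex) by move=> ? ? [].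
rewrite -(fintype.card_image inl_inj Q); apply: eq_card => -[y|y]; rewrite finset.inE.
  by apply/idP/fintype.imageP => [Qy|[? Qy [->]]]; first by exists y.
by apply/esym/negbTE/negP => /fintype.imageP[].
Qed.

Lemma card_inr (Q : pred point) :
  #|[pred w : pvertex | if w is inr y then Q y else false]| = #|Q|.
Proof.
have inr_inj : injective (inr : point -> pvertex) by move=> ? ? [].
rewrite -(fintype.card_image inr_inj Q); apply: eq_card => -[y|y]; rewrite finset.inE.
  by apply/esym/negbTE/negP => /fintype.imageP[].
by apply/idP/fintype.imageP => [Qy|[? Qy [->]]]; first by exists y.
Qed.

Lemma card_point (Q : pred V) :
  #|[pred y : point | Q (val y)]| = #|[pred y | normalized y && Q y]|.
Proof.
rewrite -(fintype.card_image (@val_inj _ _ point)); apply: eq_card => y.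
rewrite [RHS]finset.inE; apply/fintype.imageP/andP => [[x Qx ->]|[ny Qy]].
  by split; first exact: valP x.
by exists (exist _ y ny).
Qed.

(** * Block structure of the incidence model *)

Lemma padj_sym : symmetric padj.
Proof. by case=> [x|x] [y|y]. Qed.

Lemma pblock_refl d : reflexive (pblock d).
Proof.
have cc x : congr_at p d x x.
  rewrite /congr_at subrr; apply/orP; right; apply/forallP => i.
  by rewrite mxE pdvd0.
by case=> x; apply: cc.
Qed.

Lemma pblock_sym d : symmetric (pblock d).
Proof.
have cc x y : congr_at p d x y -> congr_at p d y x.
  move=> /orP[d0|/forallP dx]; apply/orP; [by left|right].
  by apply/forallP => i; have := pdvdN (dx i); rewrite !mxE opprB.
by case=> [x|x] [y|y] //=; apply/idP/idP; apply: cc.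
Qed.

Lemma pblock_trans d : transitive (pblock d).
Proof.
have cc y x z : congr_at p d x y -> congr_at p d y z -> congr_at p d x z.
  move=> /orP[d0 _|/forallP dxy /orP[d0|/forallP dyz]]; apply/orP; [by left|by left|right].
  by apply/forallP => i; have := pdvdD (dxy i) (dyz i); rewrite !mxE addrA subrK.
by case=> [y|y] [x|x] [z|z] //=; apply: cc.
Qed.

Lemma pblock_nested d z w : pblock d.+1 z w -> pblock d z w.
Proof.
have cc x y : congr_at p d.+1 x y -> congr_at p d x y.
  move=> /forallP dxy; apply/orP; right; apply/forallP => i.
  exact: pdvdW (leqnSn d) (dxy i).
by case: z w => [x|x] [y|y] //=; apply: cc.
Qed.

Lemma pblock_last z w : pblock r z w = (z == w).
Proof.
have cc x y : congr_at p r x y = (x == y).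
  rewrite /congr_at eqn0Ngt (chain_gt0 Achain) /=; apply/forallP/eqP => [xy|-> i].
    apply/rowP => i; apply/eqP; rewrite -subr_eq0.
    by have := xy i; rewrite !mxE (pdvd_ge Achain).
  by rewrite !mxE subrr pdvd0.
by case: z w => [x|x] [y|y] //=; rewrite cc.
Qed.

Lemma card_pblock d z : #|pblock d z| = block_size q r d.
Proof.
have cc (x : point) : #|[pred y : point | congr_at p d (val x) (val y)]| = block_size q r d.
  rewrite (card_point (congr_at p d (val x))); case: d => [|d] /=.
    by rewrite -(card_points Achain); apply: eq_card => y; rewrite !finset.inE andbT.
  by rewrite -(card_class Achain _ (valP x)).
by case: z => x; rewrite -(cc x) ?card_inl ?card_inr -?card_inl -?card_inr;
  apply: eq_card => -[y|y].
Qed.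

Lemma padj_block0 z w : padj z w -> ~~ pblock 0 z w.
Proof. by case: z w => [x|x] [y|y]. Qed.

Lemma padj_common0 z w t : padj z t -> padj t w -> pblock 0 z w.
Proof. by case: z w t => [x|x] [y|y] [t|t]. Qed.

Lemma card_padj z : #|padj z| = degree q r.
Proof.
rewrite /degree; case: z => x; rewrite -(card_degree Achain (point_unimodular x)) -card_point.
  by rewrite -card_inr; apply: eq_card => -[y|y]; rewrite -!topredE //= dotC.
by rewrite -card_inl; apply: eq_card => -[y|y].
Qed.

Lemma card_padj2 d z w : (d < r)%N -> pblock d z w -> ~~ pblock d.+1 z w ->
  #|[pred t | padj z t && padj t w]| = (q ^ d)%N.
Proof.
case: z w => [x|x] [y|y] //= dr c0 c1;
  rewrite -(card_common Achain dr (valP x) (valP y) c0 c1) -card_point.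
  by rewrite -card_inr; apply: eq_card => -[t|t]; rewrite -!topredE //= !(dotC (val t)).
by rewrite -card_inl; apply: eq_card => -[t|t]; rewrite -!topredE.
Qed.

Lemma card_eq_pred (T : finType) (X : Type) (f : T -> X) (B : pred T) (S : set X) :
    injective f -> (forall x, S x <-> exists2 t, B t & f t = x) ->
  (S #= `I_#|B|)%card.
Proof.
move=> fI SB; have -> : S = f @` [set` B] by apply/funext => x; apply/propext/SB.
apply: card_eq_trans (inj_card_eq (in2W fI)) _.
apply/card_set_bijP; exists (fun t => index t (enum B)); split.
- by move=> t Bt; rewrite /= cardE index_mem mem_enum.
- move=> t u; rewrite !inE /= => Bt Bu E.
  by rewrite -(@nth_index _ t t (enum B)) ?mem_enum // E nth_index ?mem_enum.
- move=> i /= ilt; have t0 : T.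
    by move: ilt; rewrite cardE; case: (enum B) => // t.
  rewrite cardE in ilt; exists (nth t0 (enum B) i).
    by have := mem_nth t0 ilt; rewrite mem_enum.
  by rewrite index_uniq ?enum_uniq.
Qed.

(** * Regularity, order, connectedness and bipartition *)

Local Notation k := (degree q r).
Local Notation G := (free_projective_plane A).

Lemma plane_regular : regular G k.
Proof.
move=> M; have [z <-] := vertex_of_surj M; rewrite -(card_padj z).
apply: (card_eq_pred vertex_of_inj) => N; split=> [zN|[w zw <-]].
  by have [w wN] := vertex_of_surj N; exists w => //; apply/vertex_of_adj; rewrite wN.
exact/vertex_of_adj.
Qed.

Lemma card_pvertex : #|{: pvertex}| = (2 * (q ^ 2 + q + 1) * q ^ (2 * (r - 1)))%N.
Proof.
rewrite card_sum addnn -mul2n -mulnA; congr (2 * _)%N.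
by rewrite -(card_points Achain) card_sig; apply: eq_card.
Qed.

Lemma card_plane : [set: G] #= `I_(2 * (q ^ 2 + q + 1) * q ^ (2 * (r - 1))).
Proof.
rewrite -card_pvertex; apply: (card_eq_pred vertex_of_inj) => M; split=> // _.
by have [z zM] := vertex_of_surj M; exists z.
Qed.

Lemma exists_neighbour z : exists w, padj z w.
Proof.
have /card_gt0P[w zw] : (0 < #|padj z|)%N; last by exists w.
by rewrite card_padj /degree addn1 muln_gt0 /= expn_gt0 (ltnW q_gt1).
Qed.

Lemma common_neighbour z w : pblock 0 z w -> exists2 t, padj z t & padj t w.
Proof.
move=> zw; have [<-|neq] := eqVneq z w.
  by have [t zt] := exists_neighbour z; exists t => //; rewrite padj_sym.
have exN : exists m, ~~ pblock m z w by exists r; rewrite pblock_last.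
case: (ex_minnP exN) => -[|d] nEd dmin; first by rewrite zw in nEd.
have Ed : pblock d z w by apply/negPn/negP => /dmin; rewrite ltnn.
have dr : (d < r)%N by apply: dmin; rewrite pblock_last.
have /card_gt0P[t /andP[]] : (0 < #|[pred t | padj z t && padj t w]|)%N.
  by rewrite (card_padj2 dr Ed nEd) expn_gt0 (ltnW q_gt1).
by exists t.
Qed.

(** Vertices on the same side have a common neighbour, hence are two steps apart; [z] and one of its
    neighbours reach the two sides. *)
Lemma padj_connected (S : pvertex -> Prop) z : S z ->
  (forall x y, S x -> padj x y -> S y) -> forall w, S w.
Proof.
move=> Sz Sadj; have S0 x y : S x -> pblock 0 x y -> S y.
  move=> Sx /common_neighbour[t xt ty].
  exact: (Sadj t y (Sadj x t Sx xt) ty).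
move=> w; have [t zt] := exists_neighbour z.
have St := Sadj _ _ Sz zt.
by case: z w t Sz zt St => [x|x] [y|y] [t|t] // Sz _ St;
  first [exact: S0 Sz _ | exact: S0 St _].
Qed.

Lemma plane_connected : connected G.
Proof.
move=> M N; have [w <-] := vertex_of_surj N; have [z <-] := vertex_of_surj M.
apply: (padj_connected (S := fun w => clos_refl_trans G (@adj G) (vertex_of z) (vertex_of w))).
  exact: rt_refl.
move=> x y zx xy; apply: rt_trans zx _; apply: rt_step; exact/vertex_of_adj.
Qed.

Lemma plane_bipartite : bipartite G.
Proof.
have [g gK] := choice vertex_of_surj.
exists (fun M => if g M is inl _ then true else false) => M N.
by rewrite -{1}(gK M) -{1}(gK N) => /vertex_of_adj; case: (g M) (g N) => [x|x] [y|y].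
Qed.

Lemma plane_block_graph n (h : 'I_n -> pvertex) : bijective h ->
  block_graph q r (fun i j => padj (h i) (h j)) (fun d i j => pblock d (h i) (h j)).
Proof.
move=> [h' hK h'K]; have cardh (Q : pred pvertex) : #|[pred i | Q (h i)]| = #|Q|.
  rewrite -(fintype.card_image (can_inj hK)); apply: eq_card => z.
  apply/fintype.imageP/idP => [[i Qi ->]//|Qz]; exists (h' z); rewrite ?h'K //.
  by rewrite finset.inE h'K.
split=> //=.
- exact: chain_gt0 Achain.
- by move=> d i; apply: pblock_refl.
- by move=> d i j; apply: pblock_sym.
- by move=> d i j l; apply: pblock_trans.
- by move=> d i j; apply: pblock_nested.
- by move=> i j; rewrite pblock_last (can_eq hK).
- by move=> d i; rewrite -(card_pblock d (h i)) -cardh; apply: eq_card.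
- by move=> i j; apply: padj_sym.
- by move=> i j; apply: padj_block0.
- by move=> i j l; apply: padj_common0.
- move=> d i j dr c0 c1; rewrite -(card_padj2 dr c0 c1) -cardh; exact: eq_card.
- by move=> i; rewrite -(card_padj (h i)) -cardh; apply: eq_card.
- move=> S i Si Sadj j; rewrite -(hK j).
  apply: (padj_connected (S := fun z => S (h' z)) (z := h i)); first by rewrite hK.
  by move=> x y Sx xy; apply: Sadj Sx _; rewrite !h'K.
Qed.

(** * Adjacency matrices and eigenvalues of the plane *)

Variable R : realType.

Lemma adj_mx_vertex_of n (e : 'I_n -> G) (h : 'I_n -> pvertex) :
  (forall i, vertex_of (h i) = e i) ->
  adj_mx R e = \matrix_(i, j) (padj (h i) (h j))%:R.
Proof.
move=> eE; apply/matrixP => i j; rewrite !mxE; congr (nat_of_bool _)%:R.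
by apply/asboolP/idP; rewrite -!eE => /vertex_of_adj.
Qed.

Lemma enum_plane n (e : 'I_n -> G) : bijective e ->
  exists2 h : 'I_n -> pvertex, bijective h & forall i, vertex_of (h i) = e i.
Proof.
move=> [e' eK e'K]; have [g gK] := choice vertex_of_surj.
have gK' z : g (vertex_of z) = z by apply: vertex_of_inj.
exists (g \o e) => [|i]; last exact: gK.
by exists (e' \o vertex_of) => [i|z] /=; rewrite ?gK ?eK // e'K.
Qed.

Lemma enum_plane_ex : exists n (e : 'I_n.+1 -> G), bijective e.
Proof.
have [g gK] := choice vertex_of_surj.
have gK' z : g (vertex_of z) = z by apply: vertex_of_inj.
have c0 : (0 < #|{: pvertex}|)%N.
  by rewrite card_pvertex !muln_gt0 addn1 /= expn_gt0 (ltnW q_gt1).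
have [n nE] : exists n, #|{: pvertex}| = n.+1 by exists #|{: pvertex}|.-1; rewrite prednK.
exists n; rewrite -nE; exists (vertex_of \o enum_val).
by exists (enum_rank \o g) => [i|M] /=; rewrite ?gK' ?enum_valK // enum_rankK gK.
Qed.

Lemma plane_eigenvalue n (e : 'I_n -> G) a : bijective e ->
  eigenvalue (adj_mx R e) a <->
  exists2 j, (j <= r)%N & a ^+ 2 = (block_eigenvalue q r j)%:R.
Proof.
move=> eB; case: n e eB => [|n] e eB.
  (* An empty enumeration is impossible, since the plane has a vertex. *)
  have [m [e' [e1 _ _]]] := enum_plane_ex; have [e0 _ _] := eB.
  by case: (e0 (e' ord0)).
have [h hB he] := enum_plane eB; rewrite (adj_mx_vertex_of he).
have BG := plane_block_graph hB.
by split=> [/(eigenvalue_sqr BG)|[j jr aj]] //; apply: (sqr_eigenvalue BG jr).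
Qed.

Lemma sqr_eq_nat (a : R) (m : nat) :
  a ^+ 2 = m%:R <-> a = Num.sqrt m%:R \/ a = - Num.sqrt m%:R.
Proof.
rewrite -{1}(@sqr_sqrtr _ m%:R) ?ler0n //; split=> [/eqP|[]->]; rewrite ?sqrrN //.
by rewrite eqf_sqr => /orP[]/eqP; [left|right].
Qed.

Lemma plane_spectrum : adj_spectrum G R =
  [set a : R | (a = k%:R \/ a = - k%:R) \/
           exists2 i : nat, (r <= i <= 2 * r - 1)%N &
             a = Num.sqrt (q%:R ^+ i) \/ a = - Num.sqrt (q%:R ^+ i)].
Proof.
have r0 := chain_gt0 Achain.
have kE : Num.sqrt (block_eigenvalue q r 0)%:R = k%:R :> R.
  by rewrite natrX sqrtr_sqr ger0_norm ?ler0n.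
apply/seteqP; split=> a /=.
  move=> [n [e [eB /(plane_eigenvalue _ eB)[j jr /sqr_eq_nat]]]].
  case: j jr => [_|j jr]; first by rewrite kE; left.
  (* The exponent is $i=2r-j$, which exchanges $1\le j\le r$ with $r\le i\le 2r-1$. *)
  by right; exists (2 * r - j.+1)%N; [lia|rewrite -natrX].
have [n [e eB]] := enum_plane_ex => H; exists n.+1, e; split=> //.
apply/(plane_eigenvalue _ eB); case: H => [|[i ir]].
  by rewrite -kE => /sqr_eq_nat aE; exists 0%N.
rewrite -natrX => /sqr_eq_nat aE; exists (2 * r - i)%N; first by lia.
have [j jE] : exists j, (2 * r - i = j.+1)%N by exists (2 * r - i).-1; lia.
by rewrite aE jE /=; congr (_ ^ _)%:R; lia.
Qed.

Lemma plane_second_eigenvalue :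
  second_largest_normalized_eigenvalue G k (Num.sqrt (q%:R : R) / (q%:R + 1)).
Proof.
have r0 := chain_gt0 Achain.
have [n [e eB]] := enum_plane_ex; have [h hB he] := enum_plane eB.
have [s [ss sE s1 sn]] := sorted_spectrum R (plane_block_graph hB).
exists s; split=> //; first by split=> //; exists n.+1, e; rewrite (adj_mx_vertex_of he).
rewrite sn /block_eigenvalue /degree natrM natrD natrX.
(* Since $q^{2r-1}=(q^{r-1})^2q$, the root is $q^{r-1}\sqrt q$, and $q^{r-1}$ cancels against the
   degree. *)
have -> : (2 * r - 1 = (r - 1) * 2 + 1)%N by lia.
rewrite addn1 exprSr exprM sqrtrM ?sqr_ge0 // sqrtr_sqr ger0_norm ?exprn_ge0 ?ler0n //.
rewrite natrX [_ * Num.sqrt _]mulrC -mulf_div divff ?mulr1 //.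
by rewrite expf_neq0 // pnatr_eq0 -lt0n (ltnW q_gt1).
Qed.

End Plane.

(** * Transfer from finite ring structures to arbitrary chain rings *)

Lemma chain_ring_plane (R : realType) (A : comNzRingType) (p : A) (q r : nat) :
  chain_ring p q r ->
  let G := free_projective_plane A in
  let k := ((q + 1) * q ^ (r - 1))%N in
  [/\ regular G k,
      connected G,
      bipartite G,
      [set: G] #= `I_(2 * (q ^ 2 + q + 1) * q ^ (2 * (r - 1))) &
      adj_spectrum G R =
        [set a : R | (a = k%:R \/ a = - k%:R) \/
                 exists2 i : nat, (r <= i <= 2 * r - 1)%N &
                   a = Num.sqrt (q%:R ^+ i) \/ a = - Num.sqrt (q%:R ^+ i)]] /\
  second_largest_normalized_eigenvalue G k (Num.sqrt (q%:R : R) / (q%:R + 1)).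
Proof.
move=> Ac; have [s sA] := chain_ring_enum Ac.
(* Eliminating this equality replaces [A] by its finite version; [p] and [Ac] are generalized first
   because their types depend on [A]. *)
move: p Ac; case: _ / (enum_ringE sA) => p Ac; split; first split.
- exact: plane_regular Ac.
- exact: plane_connected Ac.
- exact: plane_bipartite Ac.
- exact: card_plane Ac.
- exact: plane_spectrum Ac R.
- exact: plane_second_eigenvalue Ac R.
Qed.

Theorem theorem3p7 (R : realType) (F : fieldType) (v : discreteValuation F)
    (hF : nonarchimedean_local_field v) (p : integers v) (hp : uniformizer p)
    (q : nat) (hq : [set: residue_field v] #= `I_q)
    (r : nat) (hr : (0 < r)%N) :
  let G := free_projective_plane (integers_mod hp hr) in
  let k := ((q + 1) * q ^ (r - 1))%N in
  [/\ regular G k,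
      connected G,
      bipartite G,
      [set: G] #= `I_(2 * (q ^ 2 + q + 1) * q ^ (2 * (r - 1))) &
      adj_spectrum G R =
        [set a : R | (a = k%:R \/ a = - k%:R) \/
                 exists2 i : nat, (r <= i <= 2 * r - 1)%N &
                   a = Num.sqrt (q%:R ^+ i) \/ a = - Num.sqrt (q%:R ^+ i)]] /\
  second_largest_normalized_eigenvalue G k (Num.sqrt (q%:R : R) / (q%:R + 1)).
Proof. exact: chain_ring_plane (integers_mod_chain hp hq hr). Qed.
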